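(* Let $T>0$ be the unique positive root of $\cosh T = T\sinh T$, let $c = 1/(T\cosh T)$, let $\Sigma$ be the critical catenoid with these parameters, and let $\mathcal{L}_{\mathcal{J}}$ be its Jacobi--Steklov operator (the Dirichlet-to-Neumann map of the Jacobi operator). Then $\mathcal{L}_{\mathcal{J}}$ has exactly three eigenvalues below $1$, counted with multiplicity: $\delta = 1/\sinh^2 T$ (which is $0.4392$ rounded to four decimals), with multiplicity $1$, and $\delta = -1$, with multiplicity $2$. No eigenvalue of $\mathcal{L}_{\mathcal{J}}$ lies in the open interval $(1/\sinh^2 T,\, 1)$, i.e. $\sigma(\mathcal{L}_{\mathcal{J}}) \cap (1/\sinh^2 T,\, 1) = \varnothing$. The next eigenvalue is $\delta = 1$, with multiplicity $2$, and the smallest eigenvalue strictly larger than $1$ is $\delta \approx 2$ (equal to $2.00000$ when rounded to five decimals).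
   Context: The critical catenoid $\Sigma$ is the free boundary minimal annulus in the unit ball $\mathbb{B}^3\subset\mathbb{R}^3$ parametrized by $$X(t,\theta) = c(\cosh t\cos\theta,\ \cosh t\sin\theta,\ t),\qquad t\in[-T,T],\ \theta\in[0,2\pi]$$ ($\theta$ being $2\pi$-periodic), where $T>0$ satisfies $\cosh T = T\sinh T$ and $c = 1/(T\cosh T)$ (numerically $T\approx 1.1997$). The induced metric is $c^2\cosh^2 t\,(dt^2+d\theta^2)$ and the squared norm of the second fundamental form is $|h^\Sigma|^2 = 2/(c^2\cosh^4 t)$. The Jacobi operator is $$\mathcal{J} = \Delta_\Sigma + |h^\Sigma|^2 = \frac{1}{c^2\cosh^2 t}\Big[\partial_{tt}+\partial_{\theta\theta}+\frac{2}{\cosh^2 t}\Big].$$ Let $\eta$ be the outward unit conormal along $\partial\Sigma$, so that $\partial/\partial\eta = \pm\frac{1}{c\cosh T}\partial_t = \pm T\,\partial_t$ at $t=\pm T$. Jacobi--Steklov operator: given $h\in C^\infty(\partial\Sigma)$, a Jacobi extension $\hat h$ of $h$ is a solution of $\mathcal{J}\hat h = 0$ in $\Sigma$ with $\hat h = h$ on $\partial\Sigma$. Let $\mathrm{J}_0^0$ be the space of $w\in C^\infty(\Sigma)$ with $\mathcal{J}w=0$ in $\Sigma$ and $w=0$ on $\partial\Sigma$. A Jacobi extension of $h$ exists if and only if $h$ is $L^2(\partial\Sigma)$-orthogonal to all conormal derivatives $\partial w/\partial\eta|_{\partial\Sigma}$ with $w\in \mathrm{J}_0^0$, and it is then unique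 up to adding an element of $\mathrm{J}_0^0$. On this admissible subspace the Dirichlet-to-Neumann map is $\mathcal{L}_{\mathcal{J}}h = \partial\hat h/\partial\eta$. Thus $\delta\in\mathbb{R}$ is an eigenvalue of $\mathcal{L}_{\mathcal{J}}$ if there is a nonzero $h\in C^\infty(\partial\Sigma)$ having a Jacobi extension $\hat h$ with $\partial\hat h/\partial\eta = \delta h$ on $\partial\Sigma$; its multiplicity is the dimension of the space of such $h$ (together with $0$). The spectrum $\sigma(\mathcal{L}_{\mathcal{J}})$ is the set of eigenvalues. Equivalently, after separating variables into Fourier modes $f(t)\cos n\theta$, $f(t)\sin n\theta$ (with $n=0,1,2,\dots$), one seeks $f\not\equiv 0$ with $$f''(t)+\Big(\frac{2}{\cosh^2 t}-n^2\Big)f(t)=0 \text{ on } (-T,T),\qquad Tf'(T)=\delta f(T),\quad -Tf'(-T)=\delta f(-T),$$ each solution for $n\ge 1$ yielding two independent eigenfunctions ($\cos n\theta$ and $\sin n\theta$) and each solution for $n=0$ yielding one. *)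

(* Defs.v *)
From Stdlib Require Import Reals List.
From Coquelicot Require Import Coquelicot.
Open Scope R_scope.

Definition vec : Type := (R * R * R)%type.
Definition x1 (v : vec) : R := fst (fst v).
Definition x2 (v : vec) : R := snd (fst v).
Definition x3 (v : vec) : R := snd v.

Definition dot (v w : vec) : R := x1 v * x1 w + x2 v * x2 w + x3 v * x3 w.
Definition scal3 (a : R) (v : vec) : vec := (a * x1 v, a * x2 v, a * x3 v).
Definition cross (v w : vec) : vec :=
  (x2 v * x3 w - x3 v * x2 w, x3 v * x1 w - x1 v * x3 w, x1 v * x2 w - x2 v * x1 w).

Definition partial_vec (m k : nat) (X : R -> R -> vec) (t th : R) : vec :=
  (partial_derive m k (fun s r => x1 (X s r)) t th,
   partial_derive m k (fun s r => x2 (X s r)) t th,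
   partial_derive m k (fun s r => x3 (X s r)) t th).

(* First fundamental form E dt^2 + 2 F dt dth + G dth^2. *)
Definition metE (X : R -> R -> vec) (t th : R) : R :=
  dot (partial_vec 1 0 X t th) (partial_vec 1 0 X t th).
Definition metF (X : R -> R -> vec) (t th : R) : R :=
  dot (partial_vec 1 0 X t th) (partial_vec 0 1 X t th).
Definition metG (X : R -> R -> vec) (t th : R) : R :=
  dot (partial_vec 0 1 X t th) (partial_vec 0 1 X t th).
Definition metdet (X : R -> R -> vec) (t th : R) : R :=
  metE X t th * metG X t th - metF X t th ^ 2.

Definition unit_normal (X : R -> R -> vec) (t th : R) : vec :=
  let N := cross (partial_vec 1 0 X t th) (partial_vec 0 1 X t th) in
  scal3 (/ sqrt (dot N N)) N.

(* Second fundamental form h11 dt^2 + 2 h12 dt dth + h22 dth^2. *)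
Definition sff11 (X : R -> R -> vec) (t th : R) : R :=
  dot (partial_vec 2 0 X t th) (unit_normal X t th).
Definition sff12 (X : R -> R -> vec) (t th : R) : R :=
  dot (partial_vec 1 1 X t th) (unit_normal X t th).
Definition sff22 (X : R -> R -> vec) (t th : R) : R :=
  dot (partial_vec 0 2 X t th) (unit_normal X t th).

(* |h|^2 = g^{ik} g^{jl} h_ij h_kl = tr (S^2), where S = g^{-1} h. *)
Definition sff_norm2 (X : R -> R -> vec) (t th : R) : R :=
  let E := metE X t th in let F := metF X t th in let G := metG X t th in
  let D := metdet X t th in
  let h11 := sff11 X t th in let h12 := sff12 X t th in let h22 := sff22 X t th in
  let S11 := (G * h11 - F * h12) / D in
  let S12 := (G * h12 - F * h22) / D in
  let S21 := (E * h12 - F * h11) / D in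
  let S22 := (E * h22 - F * h12) / D in
  S11 ^ 2 + 2 * S12 * S21 + S22 ^ 2.

(* Delta u = det(g)^{-1/2} d_i (det(g)^{1/2} g^{ij} d_j u). *)
Definition laplace_beltrami (X : R -> R -> vec) (u : R -> R -> R) (t th : R) : R :=
  let flux1 := fun s r => (metG X s r * partial_derive 1 0 u s r
                - metF X s r * partial_derive 0 1 u s r) / sqrt (metdet X s r) in
  let flux2 := fun s r => (metE X s r * partial_derive 0 1 u s r
                - metF X s r * partial_derive 1 0 u s r) / sqrt (metdet X s r) in
  (partial_derive 1 0 flux1 t th + partial_derive 0 1 flux2 t th)
    / sqrt (metdet X t th).

Definition jacobi_op (X : R -> R -> vec) (u : R -> R -> R) (t th : R) : R :=
  laplace_beltrami X u t th + sff_norm2 X t th * u t th.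

Definition critical_height (T : R) : Prop := 0 < T /\ cosh T = T * sinh T.

Definition catenoid_scale (T : R) : R := 1 / (T * cosh T).

(* The surface is the image of [-T, T] x R; [th] has period 2 PI. *)
Definition critical_catenoid (T t th : R) : vec :=
  scal3 (catenoid_scale T) (cosh t * cos th, cosh t * sin th, t).

(* A smooth function on the compact surface is represented by a smooth extension
   to the plane of its lift to the strip [-T, T] x R; only its values and
   derivatives on that strip are ever used, and these do not depend on the
   choice of the extension. *)
Definition smooth_fun (u : R -> R -> R) : Prop :=
  (forall (n : nat) (t th : R), ex_diff_n u n t th) /\
  (forall t th : R, u t (th + 2 * PI) = u t th).

(* [(true, th)] is the boundary point with parameters (T, th), and [(false, th)]
   the one with parameters (-T, th). *)
Definition bdry : Type := (bool * R)%type.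
Definition bdry_height (T : R) (b : bool) : R := if b then T else - T.

Definition smooth_bdry_fun (h : bdry -> R) : Prop :=
  (forall (b : bool) (n : nat) (th : R), ex_derive_n (fun r => h (b, r)) n th) /\
  (forall (b : bool) (th : R), h (b, th + 2 * PI) = h (b, th)).

(* The outward unit conormal of a coordinate curve t = const is
   +/- (X_t - (F/G) X_th) / sqrt (E - F^2/G), with sign + at t = T and - at t = -T. *)
Definition conormal_derivative (T : R) (u : R -> R -> R) (p : bdry) : R :=
  let X := critical_catenoid T in
  let t := bdry_height T (fst p) in
  let th := snd p in
  (if fst p then 1 else - 1) *
  ((partial_derive 1 0 u t th
      - metF X t th / metG X t th * partial_derive 0 1 u t th)
   / sqrt (metE X t th - metF X t th ^ 2 / metG X t th)).

Definition jacobi_extension (T : R) (h : bdry -> R) (u : R -> R -> R) : Prop :=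
  smooth_fun u /\
  (forall t th : R, - T <= t <= T -> jacobi_op (critical_catenoid T) u t th = 0) /\
  (forall (b : bool) (th : R), u (bdry_height T b) th = h (b, th)).

(* The Dirichlet-to-Neumann map as a relation: [k] is the conormal derivative of
   some Jacobi extension of [h].  Extensions are only unique up to Jacobi
   functions vanishing on the boundary. *)
Definition jacobi_steklov (T : R) (h k : bdry -> R) : Prop :=
  exists u : R -> R -> R,
    jacobi_extension T h u /\ forall p : bdry, conormal_derivative T u p = k p.

Definition eigenspace (T delta : R) (h : bdry -> R) : Prop :=
  smooth_bdry_fun h /\ jacobi_steklov T h (fun p => delta * h p).

Definition spectrum (T delta : R) : Prop :=
  exists h : bdry -> R, eigenspace T delta h /\ exists p : bdry, h p <> 0.

Definition lin_comb {A : Type} (m : nat) (a : nat -> R) (e : nat -> A -> R) (x : A) : R :=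
  sum_n_m (fun i => a i * e i x) 1 m.

(* The family is indexed by 1, ..., m, so that m = 0 is the zero space. *)
Definition has_dimension {A : Type} (V : (A -> R) -> Prop) (m : nat) : Prop :=
  exists e : nat -> A -> R,
    (forall i : nat, (1 <= i <= m)%nat -> V (e i)) /\
    (forall a : nat -> R, (forall x : A, lin_comb m a e x = 0) ->
       forall i : nat, (1 <= i <= m)%nat -> a i = 0) /\
    (forall h : A -> R, V h ->
       exists a : nat -> R, forall x : A, h x = lin_comb m a e x).

Definition multiplicity (T delta : R) (m : nat) : Prop :=
  has_dimension (eigenspace T delta) m.

(* Exactly [N] eigenvalues below [s], counted with multiplicity: [l] lists the
   distinct eigenvalues below [s], each paired with its multiplicity. *)
Definition eigenvalue_count_below (T s : R) (N : nat) : Prop :=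
  exists l : list (R * nat),
    NoDup (map fst l) /\
    (forall delta : R, In delta (map fst l) <-> spectrum T delta /\ delta < s) /\
    (forall (delta : R) (m : nat), In (delta, m) l -> multiplicity T delta m) /\
    list_sum (map snd l) = N.

Definition next_eigenvalue (T a b : R) : Prop :=
  a < b /\ spectrum T b /\ forall delta : R, a < delta < b -> ~ spectrum T delta.

Definition rounds_to (x : R) (d : nat) (y : R) : Prop :=
  Rabs (x - y) < / 2 * / 10 ^ d.

(* Main.v *)
Require Import Defs.
From Stdlib Require Import Reals Arith List Lra Lia.
From Coquelicot Require Import Coquelicot.
Open Scope R_scope.

(* Separate variables without solving the equation. If [u] extends an eigenfunction [h]
   for [delta], its Fourier coefficients in the angle satisfy the mode equation
   [f'' + (2 / cosh^2 - n^2) f = 0] on [-T, T]; the constancy of their Wronskian with an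
   explicit even or odd solution [g] gives
   [(delta g(T) - T g'(T)) (H_+ +/- H_-) = 0], where [H_+], [H_-] are the [n]-th
   coefficients of [h] on the two boundary circles. The Robin quotients [T g'(T) / g(T)],
   computed with [tanh T = 1 / T], are
   - n = 0: [1 / sinh^2 T = T^2 - 1] (odd), and none for the even solution
     [1 - t tanh t], which vanishes at [T];
   - n = 1: [-1] (even) and [1] (odd);
   - n >= 2: at least [2], with equality for the even solution with [n = 2],
     so that the first eigenvalue above [1] is exactly [2].
   Hence for [delta < 2] only the listed modes of [h] can be nonzero, and the
   completeness of the trigonometric system determines [h]. *)

(** * Hyperbolic functions and the critical height *)

(** The gaps and the multiplicities concern every smooth eigenfunction, so vanishing Fourier
    coefficients must be shown to force [h] to vanish. Coefficients are taken against
    [cos (n (s - x))] with a free centre [x]: varying [x] covers sines and cosines at once, and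
    completeness becomes a claim about the single value at [x], proved by testing against powers of
    a kernel that peaks there. An extension is determined only up to Jacobi functions vanishing on
    the boundary, but the Wronskian relation involves boundary data alone, so the choice of
    extension never enters. The exceptional modes below 2 come from ambient motions, through the
    normal component of their velocity: vertical translation gives 1 / sinh^2 T, horizontal
    translations give -1, rotations about horizontal axes give 1, and dilation gives the field that
    vanishes on the boundary. *)

Lemma cosh_pos (x : R) : 0 < cosh x.
Proof. unfold cosh. pose proof (exp_pos x). pose proof (exp_pos (- x)). lra. Qed.

Lemma cosh_neq_0 (x : R) : cosh x <> 0.
Proof. apply Rgt_not_eq, cosh_pos. Qed.

Lemma cosh_opp (x : R) : cosh (- x) = cosh x.
Proof. unfold cosh. rewrite Ropp_involutive. lra. Qed.

Lemma sinh_opp (x : R) : sinh (- x) = - sinh x.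
Proof. unfold sinh. rewrite Ropp_involutive. lra. Qed.

Lemma cosh_sqr (x : R) : cosh x ^ 2 = 1 + sinh x ^ 2.
Proof.
  unfold cosh, sinh.
  assert (H : exp x * exp (- x) = 1) by (rewrite <- exp_plus, Rplus_opp_r; apply exp_0).
  nra.
Qed.

Lemma cosh_plus (x y : R) : cosh (x + y) = cosh x * cosh y + sinh x * sinh y.
Proof. unfold cosh, sinh. rewrite Ropp_plus_distr, !exp_plus. lra. Qed.

Lemma sinh_plus (x y : R) : sinh (x + y) = sinh x * cosh y + cosh x * sinh y.
Proof. unfold cosh, sinh. rewrite Ropp_plus_distr, !exp_plus. lra. Qed.

Lemma sinh_nonneg (x : R) : 0 <= x -> 0 <= sinh x.
Proof.
  intros [Hx | <-]; [| rewrite sinh_0; lra].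
  left. rewrite <- sinh_0. now apply sinh_lt.
Qed.

(** * Numerical enclosure of the critical height *)

Lemma Derive_n_exp (n : nat) (x : R) : Derive_n exp n x = exp x.
Proof.
  revert x; induction n as [|n IH]; intros x; [reflexivity|].
  simpl. rewrite (Derive_ext _ exp); [| exact IH].
  apply is_derive_unique. auto_derive; [easy | lra].
Qed.

Lemma ex_derive_n_exp (n : nat) (x : R) : ex_derive_n exp n x.
Proof.
  destruct n as [|n]; [exact I|].
  apply ex_derive_ext with exp; [intros t; symmetry; apply Derive_n_exp |].
  auto_derive; easy.
Qed.

(** The Lagrange remainder is [exp z] times the next Taylor term, with [0 < z < y]. Replacing
    [exp z] by [exp y] and collecting [exp y] on one side yields an upper bound that presupposes no
    estimate of [exp y]. *)
Lemma exp_taylor_bounds (n : nat) (y : R) :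
  0 < y ->
  sum_f_R0 (fun m => y ^ m / INR (fact m)) n <= exp y /\
  exp y * (1 - y ^ S n / INR (fact (S n)))
    <= sum_f_R0 (fun m => y ^ m / INR (fact m)) n.
Proof.
  intros Hy.
  destruct (Taylor_Lagrange exp n 0 y Hy) as (z & Hz & Heq).
  { intros; apply ex_derive_n_exp. }
  rewrite Derive_n_exp, Rminus_0_r in Heq.
  rewrite (sum_eq _ (fun m => y ^ m / INR (fact m))) in Heq.
  2: { intros i _. rewrite Derive_n_exp, exp_0. ring. }
  assert (Hr : 0 < y ^ S n / INR (fact (S n))).
  { apply Rdiv_lt_0_compat; [now apply pow_lt | apply INR_fact_lt_0]. }
  pose proof (exp_pos z). assert (exp z < exp y) by (apply exp_increasing; lra).
  split; nra.
Qed.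

Definition height_gap (t : R) : R := cosh t - t * sinh t.

Lemma height_gap_decreasing (x y : R) : 0 < x < y -> height_gap y < height_gap x.
Proof.
  intros Hxy.
  enough (- height_gap x < - height_gap y) by lra.
  apply (incr_function (fun t => - height_gap t) 0 p_infty (fun t => t * cosh t));
    simpl; try easy.
  - intros t _ _. unfold height_gap. auto_derive; [easy | ring].
  - intros t Ht _. apply Rmult_lt_0_compat; [easy | apply cosh_pos].
Qed.

(** Clearing [exp (- t)] leaves an expression that decreases in [exp t] when [t > 1]. So an upper
    bound on the exponential proves the gap positive, and a lower bound proves it negative. *)
Lemma height_gap_exp (t : R) :
  2 * exp t * height_gap t = 1 + t - exp t ^ 2 * (t - 1).
Proof.
  unfold height_gap, cosh, sinh.
  assert (H : exp t * exp (- t) = 1) by (rewrite <- exp_plus, Rplus_opp_r; apply exp_0).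
  replace (1 + t) with (exp t * exp (- t) * (1 + t)) by (rewrite H; ring). field.
Qed.

Lemma height_gap_lower : 0 < height_gap 1.19966.
Proof.
  destruct (exp_taylor_bounds 11 1.19966) as [_ H]; [lra|].
  pose proof (height_gap_exp 1.19966) as He.
  set (e := exp 1.19966) in *.
  assert (e0 : 0 < e) by apply exp_pos.
  assert (Hu : e <= 3.31905).
  { cbn [sum_f_R0] in H. rewrite !fact_simpl, !mult_INR, !INR_IZR_INZ in H.
    cbn [fact Z.of_nat Pos.of_succ_nat Pos.succ] in H. lra. }
  nra.
Qed.

Lemma height_gap_upper : height_gap 1.199685 < 0.
Proof.
  destruct (exp_taylor_bounds 11 1.199685) as [H _]; [lra|].
  pose proof (height_gap_exp 1.199685) as He.
  set (e := exp 1.199685) in *.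
  assert (e0 : 0 < e) by apply exp_pos.
  assert (Hu : 3.31904 <= e).
  { cbn [sum_f_R0] in H. rewrite !fact_simpl, !mult_INR, !INR_IZR_INZ in H.
    cbn [fact Z.of_nat Pos.of_succ_nat Pos.succ] in H. lra. }
  nra.
Qed.

Lemma critical_height_gap (T : R) :
  critical_height T <-> 0 < T /\ height_gap T = 0.
Proof. unfold critical_height, height_gap. split; intros [H1 H2]; split; lra. Qed.

(** The bracket is narrow enough for [T ^ 2 - 1] to round to 0.4392. The right end is the tight one,
    because [T ^ 2 - 1] is about 0.43923 and must stay below 0.43925. *)
Lemma critical_height_bounds (T : R) : critical_height T -> 1.19966 < T < 1.199685.
Proof.
  rewrite critical_height_gap; intros [HT Hg].
  pose proof height_gap_lower. pose proof height_gap_upper.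
  split; apply Rnot_le_lt; intros [H1 | H1].
  - pose proof (height_gap_decreasing T 1.19966). lra.
  - subst; lra.
  - pose proof (height_gap_decreasing 1.199685 T). lra.
  - subst; lra.
Qed.

Lemma critical_height_unique : exists! T : R, critical_height T.
Proof.
  pose proof height_gap_lower as Hl. pose proof height_gap_upper as Hu.
  destruct (IVT (fun t => - height_gap t) 1.19966 1.199685) as (T & HT & HT0); try lra.
  - intros t. apply derivable_continuous_pt. exists (t * cosh t). apply is_derive_Reals.
    unfold height_gap. auto_derive; [easy | ring].
  - exists T. split.
    + apply critical_height_gap. lra.
    + intros S HS. apply critical_height_gap in HS.
      destruct (Rtotal_order T S) as [H | [H | H]]; [|easy|].
      * pose proof (height_gap_decreasing T S). lra.
      * pose proof (height_gap_decreasing S T). lra.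
Qed.

Lemma critical_height_gt_1 (T : R) : critical_height T -> 1 < T.
Proof. intros HT. pose proof (critical_height_bounds T HT). lra. Qed.

Lemma critical_cosh (T : R) : critical_height T -> cosh T = T * sinh T.
Proof. now intros [_ H]. Qed.

Lemma critical_sinh_pos (T : R) : critical_height T -> 0 < sinh T.
Proof. intros [H _]. rewrite <- sinh_0. now apply sinh_lt. Qed.

Lemma critical_sinh_sqr (T : R) : critical_height T -> sinh T ^ 2 * (T ^ 2 - 1) = 1.
Proof. intros HT. pose proof (cosh_sqr T) as H. rewrite (critical_cosh T HT) in H. nra. Qed.

Lemma inv_sinh_sqr (T : R) : critical_height T -> 1 / sinh T ^ 2 = T ^ 2 - 1.
Proof.
  intros HT. pose proof (critical_sinh_pos T HT). pose proof (critical_sinh_sqr T HT) as Hs.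
  assert (Hp : sinh T ^ 2 <> 0) by (apply pow_nonzero; lra).
  apply (Rmult_eq_reg_l (sinh T ^ 2)); [rewrite Hs; field; lra | easy].
Qed.

(* Equivalent to tanh (n T) >= tanh (2 T), where tanh (2 T) = 2 T / (T^2 + 1). *)
Lemma tanh_mode_lower (T n : R) :
  critical_height T -> 2 <= n -> 2 * T * cosh (n * T) <= (T ^ 2 + 1) * sinh (n * T).
Proof.
  intros HT Hn. pose proof (critical_height_gt_1 T HT) as H1.
  replace (n * T) with ((T + T) + (n - 2) * T) by ring.
  rewrite (cosh_plus (T + T)), (sinh_plus (T + T)), (cosh_plus T T), (sinh_plus T T), (critical_cosh T HT).
  assert (Hk : 0 <= sinh ((n - 2) * T)) by (apply sinh_nonneg; nra).
  set (s := sinh T) in *. set (sk := sinh ((n - 2) * T)) in *.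
  set (ck := cosh ((n - 2) * T)).
  (* After the addition formulas the terms in [ck] cancel, and the two sides differ by exactly this
     product, which is zero for [n = 2]. *)
  enough (0 <= s ^ 2 * sk * (T ^ 2 - 1) ^ 2) by lra.
  apply Rmult_le_pos; [apply Rmult_le_pos; [apply pow2_ge_0 | easy] | apply pow2_ge_0].
Qed.

(** * Completeness of the trigonometric system *)

(** Unnormalised. The period is centred at [x] as well, so that at the endpoints [s - x] is plus or
    minus [PI], where every [sin (n (s - x))] vanishes. *)
Definition cos_coef (f : R -> R) (n : nat) (x : R) : R :=
  RInt (fun s => f s * cos (INR n * (s - x))) (x - PI) (x + PI).

Lemma ex_RInt_cont (f : R -> R) (a b : R) : (forall s, continuous f s) -> ex_RInt f a b.
Proof. intros H. apply (ex_RInt_continuous (V := R_CompleteNormedModule)). auto. Qed.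

Lemma continuous_Rmult (f g : R -> R) (x : R) :
  continuous f x -> continuous g x -> continuous (fun s => f s * g s) x.
Proof. apply (continuous_mult f g). Qed.

Lemma continuous_Rplus (f g : R -> R) (x : R) :
  continuous f x -> continuous g x -> continuous (fun s => f s + g s) x.
Proof. apply (continuous_plus f g). Qed.

Ltac continuity_explicit :=
  apply (ex_derive_continuous (K := R_AbsRing) (V := R_NormedModule)); auto_derive; easy.

Lemma cos_coef_ex (f : R -> R) (n : nat) (x a b : R) :
  (forall s, continuous f s) -> ex_RInt (fun s => f s * cos (INR n * (s - x))) a b.
Proof.
  intros Hf. apply ex_RInt_cont; intros s. apply continuous_Rmult; [easy | continuity_explicit].
Qed.

Lemma RInt_Rext (f g : R -> R) (a b : R) :
  (forall s, f s = g s) -> RInt f a b = RInt g a b.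
Proof. intros H. apply RInt_ext. intros s _. apply H. Qed.

Lemma RInt_Rplus (f g : R -> R) (a b : R) :
  ex_RInt f a b -> ex_RInt g a b ->
  RInt (fun s => f s + g s) a b = RInt f a b + RInt g a b.
Proof. apply (RInt_plus f g). Qed.

Lemma RInt_Rscal (f : R -> R) (a b c : R) :
  ex_RInt f a b -> RInt (fun s => c * f s) a b = c * RInt f a b.
Proof. apply (RInt_scal f). Qed.

Lemma RInt_derivative (f df : R -> R) (a b : R) :
  (forall s, is_derive f s (df s)) -> (forall s, continuous df s) ->
  RInt df a b = f b - f a.
Proof.
  intros Hd Hc. apply is_RInt_unique. apply (is_RInt_derive f df); auto.
Qed.

Lemma cos_coef_lin (f g : R -> R) (c d : R) (n : nat) (x : R) :
  (forall s, continuous f s) -> (forall s, continuous g s) ->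
  cos_coef (fun s => c * f s + d * g s) n x = c * cos_coef f n x + d * cos_coef g n x.
Proof.
  intros Hf Hg. unfold cos_coef.
  rewrite <- !RInt_Rscal by now apply cos_coef_ex.
  rewrite <- RInt_Rplus.
  - apply RInt_Rext. intros s. ring.
  - apply (ex_RInt_scal (V := R_NormedModule)). now apply cos_coef_ex.
  - apply (ex_RInt_scal (V := R_NormedModule)). now apply cos_coef_ex.
Qed.

(** This is [cos ((s - x) / 2) ^ 2], whose powers are the unnormalised de la Vallee Poussin kernels.
    It lies between 0 and 1 and equals 1 only at [x] within the period, so its powers concentrate
    there. *)
Definition kernel (x s : R) : R := (1 + cos (s - x)) / 2.

Lemma kernel_continuous_pow (k : nat) (x s : R) : continuous (fun r => kernel x r ^ k) s.
Proof. unfold kernel. continuity_explicit. Qed.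

(** The kernel times a cosine of frequency [n] is a combination of the frequencies [n - 1], [n] and
    [n + 1], so one more factor of the kernel preserves the vanishing of all coefficients. *)
Lemma cos_coef_kernel_pow (f : R -> R) (x : R) :
  (forall s, continuous f s) -> (forall n, cos_coef f n x = 0) ->
  forall k n, cos_coef (fun s => f s * kernel x s ^ k) n x = 0.
Proof.
  intros Hf H0 k. induction k as [|k IH]; intros n.
  { rewrite <- (H0 n). apply RInt_Rext. intros s. simpl. ring. }
  assert (Hc : forall s, continuous (fun s => f s * kernel x s ^ k) s).
  { intros s. apply continuous_Rmult; [easy | apply kernel_continuous_pow]. }
  set (g := fun s => f s * kernel x s ^ k) in *.
  assert (Hex : forall m a b, ex_RInt (fun s => g s * cos (INR m * (s - x))) a b)
    by (intros; now apply cos_coef_ex).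
  assert (Hex2 : forall c m a b, ex_RInt (fun s => c * (g s * cos (INR m * (s - x)))) a b)
    by (intros; apply (ex_RInt_scal (V := R_NormedModule)), Hex).
  (* For [n = 0] the lower neighbour is frequency -1, which by evenness of the cosine is frequency
     1; hence the value in the [O] branch. *)
  transitivity (/ 2 * cos_coef g n x
    + (/ 4 * cos_coef g (S n) x + / 4 * cos_coef g (match n with O => 1%nat | S m => m end) x)).
  2: { rewrite !IH. ring. }
  unfold cos_coef. rewrite <- !RInt_Rscal by apply Hex.
  rewrite <- !RInt_Rplus; auto.
  2: { apply (ex_RInt_plus (V := R_NormedModule)); auto. }
  apply RInt_Rext. intros s.
  transitivity (g s * (cos (INR n * (s - x)) * kernel x s)).
  { unfold g; simpl; ring. }
  unfold kernel.
  destruct n as [|m].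
  - simpl. rewrite Rmult_0_l, Rmult_1_l, cos_0. field.
  - set (y := s - x).
    assert (E1 : cos (INR (S (S m)) * y)
       = cos (INR (S m) * y) * cos y - sin (INR (S m) * y) * sin y).
    { rewrite <- cos_plus. f_equal. rewrite (S_INR (S m)). ring. }
    assert (E2 : cos (INR m * y)
       = cos (INR (S m) * y) * cos y + sin (INR (S m) * y) * sin y).
    { rewrite <- cos_minus. f_equal. rewrite (S_INR m). ring. }
    rewrite E1, E2. field.
Qed.

(* Wallis: integrate the derivative of [sin (s - x) * kernel x s ^ k] over a period. *)
Lemma kernel_pow_integral (k : nat) (x : R) :
  (2 * INR k + 2) * RInt (fun s => kernel x s ^ S k) (x - PI) (x + PI)
  = (2 * INR k + 1) * RInt (fun s => kernel x s ^ k) (x - PI) (x + PI).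
Proof.
  assert (Hex : forall j a b, ex_RInt (fun s => kernel x s ^ j) a b).
  { intros. apply ex_RInt_cont, kernel_continuous_pow. }
  enough (RInt (fun s => (2 * INR k + 2) * kernel x s ^ S k
                + (- (2 * INR k + 1)) * kernel x s ^ k) (x - PI) (x + PI) = 0 :> R) as H.
  { rewrite RInt_Rplus, !RInt_Rscal in H; auto; try lra;
      apply (ex_RInt_scal (V := R_NormedModule)); auto. }
  rewrite (RInt_derivative (fun s => sin (s - x) * kernel x s ^ k)).
  - replace (x + PI - x) with PI by ring. replace (x - PI - x) with (- PI) by ring.
    rewrite sin_neg, sin_PI. ring.
  - intros s. unfold kernel. auto_derive; [easy|].
    set (y := s + - x). replace (s - x) with y by reflexivity.
    pose proof (sin2_cos2 y) as Hp. unfold Rsqr in Hp.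
    destruct k as [|k].
    + simpl. field.
    + rewrite S_INR. simpl pred.
      set (p := (1 + cos y) / 2).
      assert (Hs : sin y * sin y = 4 * (p * (1 - p))) by (unfold p; nra).
      replace (cos y) with (2 * p - 1) by (unfold p; field).
      transitivity ((2 * p - 1) * p ^ S k - (INR k + 1) * p ^ k * (sin y * sin y) / 2).
      * replace ((1 + (2 * p - 1)) * / 2) with p by field. simpl; field.
      * rewrite Hs. simpl; field.
  - intros s. unfold kernel. continuity_explicit.
Qed.

Lemma kernel_pow_integral_pos (k : nat) (x : R) :
  0 < RInt (fun s => kernel x s ^ k) (x - PI) (x + PI).
Proof.
  induction k as [|k IH].
  - rewrite (RInt_ext _ (fun _ => 1)) by reflexivity.
    rewrite RInt_const. unfold scal; simpl; unfold mult; simpl. pose proof PI_RGT_0. lra.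
  - pose proof (kernel_pow_integral k x). pose proof (pos_INR k). nra.
Qed.

Lemma bounded_below_on_segment (f : R -> R) (a b : R) :
  a <= b -> (forall s, continuous f s) -> exists M, forall s, a <= s <= b -> - M <= f s.
Proof.
  intros Hab Hf.
  destruct (continuity_ab_min f a b Hab) as (m & Hm & _).
  { intros c _. apply continuity_pt_filterlim, Hf. }
  exists (- f m). intros s Hs. specialize (Hm s Hs). lra.
Qed.

(* Korovkin's comparison with [1 - cos], which lets the kernel be tested without
   splitting the integral. *)
Lemma korovkin_minorant (f : R -> R) (x : R) :
  (forall s, continuous f s) -> 0 < f x ->
  exists C, 0 <= C /\
    forall s, x - PI <= s <= x + PI -> f x / 2 - C * (1 - kernel x s) <= f s.
Proof.
  intros Hf Hx. pose proof PI_RGT_0 as HPI.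
  destruct (bounded_below_on_segment f (x - PI) (x + PI)) as (M & HM); [lra | easy |].
  assert (Hloc : locally x (fun s => f x / 2 < f s)).
  { apply (Hf x (fun y => f x / 2 < y)). apply (open_gt (f x / 2)). lra. }
  destruct Hloc as (d0 & Hd0).
  set (d := Rmin d0 PI).
  assert (Hd : 0 < d) by (apply Rmin_glb_lt; [apply cond_pos | easy]).
  assert (HdPI : d <= PI) by apply Rmin_r.
  assert (Hk1 : forall s, kernel x s <= 1).
  { intros s. unfold kernel. pose proof (COS_bound (s - x)). lra. }
  set (q := (1 - cos d) / 2).
  assert (Hq : 0 < q).
  { unfold q. pose proof (cos_decreasing_1 0 d). rewrite cos_0 in H. lra. }
  (* At distance at least [d] from [x] one has [1 - kernel x s >= q], so this [C] pushes the
     minorant below [- Rabs M], hence below [f]. *)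
  set (C := (Rabs M + f x) / q).
  assert (HC : C * q = Rabs M + f x) by (unfold C; field; lra).
  assert (HC0 : 0 <= C).
  { apply Rdiv_le_0_compat; [| easy]. pose proof (Rabs_pos M). lra. }
  exists C. split; [easy |].
  intros s Hs. specialize (Hk1 s).
  destruct (Rlt_le_dec (Rabs (s - x)) d) as [Hn | Hn].
  - assert (f x / 2 < f s).
    { apply Hd0. unfold ball; simpl; unfold AbsRing_ball, abs, minus, plus, opp; simpl.
      apply Rlt_le_trans with d; [exact Hn | apply Rmin_l]. }
    nra.
  - assert (kernel x s <= 1 - q).
    { unfold kernel, q.
      assert (Hcos : cos (s - x) = cos (Rabs (s - x))).
      { unfold Rabs. destruct (Rcase_abs _); [now rewrite cos_neg | easy]. }
      rewrite Hcos.
      enough (cos (Rabs (s - x)) <= cos d) by lra.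
      assert (0 <= Rabs (s - x) <= PI) by (split; [apply Rabs_pos | apply Rabs_le; lra]).
      apply cos_decr_1; lra. }
    specialize (HM s Hs). pose proof (Rle_abs M). nra.
Qed.

(** If [f x > 0], integrate the minorant against [kernel ^ k]. The integral of [f] against that
    power is zero, and the Wallis recurrence turns the other side into a positive integral times
    [f x / 2 - C / (2 k + 2)]. This is positive once [k > 2 C / f x], a contradiction. *)
Lemma cos_coef_zero_nonpos (f : R -> R) (x : R) :
  (forall s, continuous f s) -> (forall n, cos_coef f n x = 0) -> f x <= 0.
Proof.
  intros Hf H0. apply Rnot_lt_le. intros Hx.
  destruct (korovkin_minorant f x Hf Hx) as (C & HC & Hmin).
  pose proof PI_RGT_0 as HPI.
  destruct (INR_unbounded (2 * C / f x)) as (k & Hk).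
  pose proof (kernel_pow_integral k x) as HI.
  pose proof (kernel_pow_integral_pos k x) as Hpos.
  set (I := fun j => RInt (fun s => kernel x s ^ j) (x - PI) (x + PI)) in *.
  change (RInt (fun s => kernel x s ^ k) (x - PI) (x + PI)) with (I k) in *.
  change (RInt (fun s => kernel x s ^ S k) (x - PI) (x + PI)) with (I (S k)) in *.
  assert (Hex : forall j c, ex_RInt (fun s => c * kernel x s ^ j) (x - PI) (x + PI)).
  { intros. apply ex_RInt_cont; intros s. apply continuous_Rmult;
      [apply continuous_const | apply kernel_continuous_pow]. }
  assert (Hle : (f x / 2 - C) * I k + C * I (S k) <= 0).
  { rewrite <- (cos_coef_kernel_pow f x Hf H0 k 0). unfold I, cos_coef.
    rewrite <- !RInt_Rscal, <- RInt_Rplus; auto.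
    2, 3: apply ex_RInt_cont, kernel_continuous_pow.
    apply RInt_le; [lra | | |].
    - apply (ex_RInt_plus (V := R_NormedModule)); auto.
    - apply cos_coef_ex. intros s. apply continuous_Rmult; [easy | apply kernel_continuous_pow].
    - intros s Hs. simpl. rewrite Rmult_0_l, cos_0, Rmult_1_r.
      assert (Hp : 0 <= kernel x s ^ k).
      { apply pow_le. unfold kernel. pose proof (COS_bound (s - x)). lra. }
      assert (Hm : f x / 2 - C * (1 - kernel x s) <= f s) by (apply Hmin; lra).
      nra. }
  pose proof (pos_INR k).
  assert (Hk' : 2 * C < INR k * f x).
  { apply (Rmult_lt_compat_r (f x)) in Hk; [| easy]. unfold Rdiv in Hk.
    rewrite Rmult_assoc, Rinv_l, Rmult_1_r in Hk; lra. }
  assert (E : I (S k) = I k - I k / (2 * INR k + 2)).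
  { apply (Rmult_eq_reg_l (2 * INR k + 2)); [| lra]. rewrite HI. field. lra. }
  rewrite E in Hle.
  assert (Hfin : I k * (f x / 2 - C / (2 * INR k + 2)) <= 0) by (unfold Rdiv in *; lra).
  assert (0 < f x / 2 - C / (2 * INR k + 2)).
  { apply (Rmult_lt_reg_r (2 * INR k + 2)); [lra|].
    replace ((f x / 2 - C / (2 * INR k + 2)) * (2 * INR k + 2))
      with (f x * (INR k + 1) - C) by (field; lra). nra. }
  nra.
Qed.

Lemma cos_coef_zero (f : R -> R) (x : R) :
  (forall s, continuous f s) -> (forall n, cos_coef f n x = 0) -> f x = 0.
Proof.
  intros Hf H0. apply Rle_antisym.
  - now apply cos_coef_zero_nonpos.
  - enough (- f x <= 0) by lra.
    apply (cos_coef_zero_nonpos (fun s => - f s)).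
    + intros s. apply (continuous_opp f), Hf.
    + intros n. transitivity (cos_coef (fun s => (-1) * f s + 0 * f s) n x).
      * apply RInt_Rext. intros s. ring.
      * rewrite cos_coef_lin, H0 by easy. ring.
Qed.

(** Multiplied by [m ^ 2 - n ^ 2], the integrand is the derivative of the Wronskian of the two
    cosines, which vanishes at both ends of the period. *)
Lemma cos_coef_orthogonal (m n : nat) (x : R) :
  n <> m -> cos_coef (fun s => cos (INR m * (s - x))) n x = 0.
Proof.
  intros Hmn.
  assert (Hne : INR m ^ 2 - INR n ^ 2 <> 0).
  { replace (INR m ^ 2 - INR n ^ 2) with ((INR m - INR n) * (INR m + INR n)) by ring.
    assert (INR m <> INR n) by (intros H; apply Hmn; now apply INR_eq in H).
    pose proof (pos_INR m). pose proof (pos_INR n).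
    apply Rmult_integral_contrapositive. split; lra. }
  apply (Rmult_eq_reg_l (INR m ^ 2 - INR n ^ 2)); [| easy].
  rewrite Rmult_0_r. unfold cos_coef. rewrite <- RInt_Rscal.
  2: { apply cos_coef_ex. intros s. continuity_explicit. }
  rewrite (RInt_derivative (fun s =>
    INR n * sin (INR n * (s - x)) * cos (INR m * (s - x)) * (-1)
    + INR m * sin (INR m * (s - x)) * cos (INR n * (s - x)))).
  - assert (Hs : forall k, sin (INR k * PI) = 0).
    { intros k. apply sin_eq_0_1. exists (Z.of_nat k). now rewrite <- INR_IZR_INZ. }
    replace (x + PI - x) with PI by ring. replace (x - PI - x) with (- PI) by ring.
    rewrite <- !Ropp_mult_distr_r, !sin_neg, !Hs. ring.
  - intros s. auto_derive; [easy|]. unfold Rminus. ring.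
  - intros s. continuity_explicit.
Qed.

Definition cos_mass (m : nat) : R := match m with O => 2 * PI | S _ => PI end.

Lemma cos_mass_pos (m : nat) : 0 < cos_mass m.
Proof. pose proof PI_RGT_0. destruct m; simpl; lra. Qed.

Lemma cos_coef_self (m : nat) (x : R) :
  cos_coef (fun s => cos (INR m * (s - x))) m x = cos_mass m.
Proof.
  unfold cos_coef. destruct m as [|m].
  - rewrite (RInt_Rext _ (fun _ => 1)).
    + rewrite RInt_const. unfold scal; simpl; unfold mult; simpl. ring.
    + intros s. simpl. rewrite Rmult_0_l, cos_0. ring.
  - assert (Hm : INR (S m) <> 0) by now apply not_0_INR.
    set (k := INR (S m)) in *.
    assert (Hs : sin (k * PI) = 0).
    { apply sin_eq_0_1. exists (Z.of_nat (S m)). unfold k. now rewrite <- INR_IZR_INZ. }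
    rewrite (RInt_derivative
      (fun s => s / 2 + sin (k * (s - x)) * cos (k * (s - x)) / (2 * k))).
    + replace (x + PI - x) with PI by ring. replace (x - PI - x) with (- PI) by ring.
      rewrite <- !Ropp_mult_distr_r, !sin_neg, !Hs. simpl. field. easy.
    + intros s. auto_derive; [easy|]. unfold Rminus. set (y := k * (s + - x)).
      pose proof (sin2_cos2 y) as Hp. unfold Rsqr in Hp.
      transitivity (/ 2 + / 2 * (cos y * cos y - sin y * sin y)); [now field | lra].
    + intros s. continuity_explicit.
Qed.

(** Subtracting the projection [c * cos (m (s - x))] kills every coefficient. Completeness is then
    read off at the centre, where this cosine equals 1. *)
Lemma single_cos_coef (f : R -> R) (m : nat) (x : R) :
  (forall s, continuous f s) -> (forall n, n <> m -> cos_coef f n x = 0) ->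
  f x = cos_coef f m x / cos_mass m.
Proof.
  intros Hf H0. pose proof (cos_mass_pos m) as Hm.
  assert (Hc : forall s, continuous (fun s => cos (INR m * (s - x))) s)
    by (intros s; continuity_explicit).
  set (c := cos_coef f m x / cos_mass m).
  assert (H : 1 * f x + (- c) * cos (INR m * (x - x)) = 0).
  { apply (cos_coef_zero (fun s => 1 * f s + (- c) * cos (INR m * (s - x)))).
    - intros s. apply continuous_Rplus; apply continuous_Rmult;
        auto using continuous_const.
    - intros n. rewrite (cos_coef_lin f) by easy.
      destruct (Nat.eq_dec n m) as [-> | Hn].
      + rewrite cos_coef_self. unfold c. field. lra.
      + rewrite H0, cos_coef_orthogonal by easy. ring. }
  rewrite Rminus_diag, Rmult_0_r, cos_0 in H. lra.
Qed.

Lemma RInt_period (f : R -> R) (x : R) :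
  (forall s, continuous f s) -> (forall s, f (s + 2 * PI) = f s) ->
  RInt f (x - PI) (x + PI) = RInt f (- PI) PI.
Proof.
  intros Hf Hp.
  assert (Hex : forall a b, ex_RInt f a b) by (intros; now apply ex_RInt_cont).
  assert (E : RInt f (-PI) (x - PI) = RInt f PI (x + PI)).
  { pose proof (RInt_comp_lin f 1 (2 * PI) (- PI) (x - PI)) as H.
    replace (1 * - PI + 2 * PI) with PI in H by ring.
    replace (1 * (x - PI) + 2 * PI) with (x + PI) in H by ring.
    rewrite <- H by auto. apply RInt_Rext. intros s.
    unfold scal; simpl; unfold mult; simpl. rewrite !Rmult_1_l. now rewrite Hp. }
  pose proof (RInt_Chasles f (-PI) (x - PI) (x + PI) (Hex _ _) (Hex _ _)) as H1.
  pose proof (RInt_Chasles f (-PI) PI (x + PI) (Hex _ _) (Hex _ _)) as H2.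
  rewrite E in H1. unfold plus in *; simpl in *. lra.
Qed.

(** Makes the dependence on the centre explicit: periodicity moves the window to a fixed period, and
    the addition formula splits off [x]. Together with [single_cos_coef] this determines [f] as a
    function. *)
Lemma cos_coef_period (f : R -> R) (n : nat) :
  (forall s, continuous f s) -> (forall s, f (s + 2 * PI) = f s) ->
  exists a b, forall x, cos_coef f n x = a * cos (INR n * x) + b * sin (INR n * x).
Proof.
  intros Hf Hp.
  exists (RInt (fun s => f s * cos (INR n * s)) (- PI) PI),
    (RInt (fun s => f s * sin (INR n * s)) (- PI) PI).
  intros x. unfold cos_coef. rewrite RInt_period.
  - rewrite Rmult_comm, (Rmult_comm _ (sin _)).
    rewrite <- !RInt_Rscal, <- RInt_Rplus.
    + apply RInt_Rext. intros s.
      replace (INR n * (s - x)) with (INR n * s - INR n * x) by ring.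
      rewrite cos_minus. ring.
    + apply ex_RInt_cont. intros s. apply continuous_Rmult; [apply continuous_const |].
      apply continuous_Rmult; [easy | continuity_explicit].
    + apply ex_RInt_cont. intros s. apply continuous_Rmult; [apply continuous_const |].
      apply continuous_Rmult; [easy | continuity_explicit].
    + apply ex_RInt_cont. intros s. apply continuous_Rmult; [easy | continuity_explicit].
    + apply ex_RInt_cont. intros s. apply continuous_Rmult; [easy | continuity_explicit].
  - intros s. apply continuous_Rmult; [easy | continuity_explicit].
  - intros s. rewrite Hp. f_equal.
    replace (INR n * (s + 2 * PI - x)) with (INR n * (s - x) + 2 * INR n * PI) by ring.
    apply cos_period.
Qed.

(** * Geometry of the critical catenoid *)

Lemma partial_derive_fst (f f1 : R -> R -> R) (t th : R) :
  (forall s, is_derive (fun z => f z th) s (f1 s th)) -> partial_derive 1 0 f t th = f1 t th.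
Proof. intros H. apply (is_derive_unique (fun z => f z th)), H. Qed.

Lemma partial_derive_snd (f f2 : R -> R -> R) (t th : R) :
  (forall r, is_derive (fun z => f t z) r (f2 t r)) -> partial_derive 0 1 f t th = f2 t th.
Proof. intros H. apply (is_derive_unique (fun z => f t z)), H. Qed.

Lemma partial_derive_fst_fst (f f1 f11 : R -> R -> R) (t th : R) :
  (forall s, is_derive (fun z => f z th) s (f1 s th)) ->
  (forall s, is_derive (fun z => f1 z th) s (f11 s th)) ->
  partial_derive 2 0 f t th = f11 t th.
Proof.
  intros H H1. rewrite <- (is_derive_unique (fun z => f1 z th) t (f11 t th) (H1 t)).
  apply (Derive_ext (fun s => partial_derive 1 0 f s th)).
  intros s. now apply partial_derive_fst.
Qed.

(** [partial_derive 1 1] differentiates in the second variable first, which dictates the order of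
    the hypotheses. *)
Lemma partial_derive_fst_snd (f f2 f12 : R -> R -> R) (t th : R) :
  (forall s r, is_derive (fun z => f s z) r (f2 s r)) ->
  (forall s, is_derive (fun z => f2 z th) s (f12 s th)) ->
  partial_derive 1 1 f t th = f12 t th.
Proof.
  intros H H1. rewrite <- (is_derive_unique (fun z => f2 z th) t (f12 t th) (H1 t)).
  apply (Derive_ext (fun s => partial_derive 0 1 f s th)).
  intros s. apply partial_derive_snd. intros r. apply H.
Qed.

Lemma partial_derive_snd_snd (f f2 f22 : R -> R -> R) (t th : R) :
  (forall r, is_derive (fun z => f t z) r (f2 t r)) ->
  (forall r, is_derive (fun z => f2 t z) r (f22 t r)) ->
  partial_derive 0 2 f t th = f22 t th.
Proof.
  intros H H1. rewrite <- (is_derive_unique (fun z => f2 t z) th (f22 t th) (H1 th)).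
  apply (Derive_ext (fun r => partial_derive 0 1 f t r)).
  intros r. now apply partial_derive_snd.
Qed.

Ltac derive_explicit := intros; auto_derive; [easy | ring].

Lemma vec_eq (a b c a' b' c' : R) : a = a' -> b = b' -> c = c' -> (a, b, c) = (a', b', c') :> vec.
Proof. now intros -> -> ->. Qed.

Lemma catenoid_t (T t th : R) :
  let c := catenoid_scale T in
  partial_vec 1 0 (critical_catenoid T) t th = (c * (sinh t * cos th), c * (sinh t * sin th), c).
Proof.
  intros c. unfold partial_vec, critical_catenoid, scal3, x1, x2, x3; simpl fst; simpl snd.
  fold c. apply vec_eq.
  - apply (partial_derive_fst _ (fun t th => c * (sinh t * cos th))). derive_explicit.
  - apply (partial_derive_fst _ (fun t th => c * (sinh t * sin th))). derive_explicit.
  - apply (partial_derive_fst _ (fun t th => c)). derive_explicit.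
Qed.

Lemma catenoid_th (T t th : R) :
  let c := catenoid_scale T in
  partial_vec 0 1 (critical_catenoid T) t th
  = (- c * (cosh t * sin th), c * (cosh t * cos th), 0).
Proof.
  intros c. unfold partial_vec, critical_catenoid, scal3, x1, x2, x3; simpl fst; simpl snd.
  fold c. apply vec_eq.
  - apply (partial_derive_snd _ (fun t th => - c * (cosh t * sin th))). derive_explicit.
  - apply (partial_derive_snd _ (fun t th => c * (cosh t * cos th))). derive_explicit.
  - apply (partial_derive_snd _ (fun t th => 0)). derive_explicit.
Qed.

Lemma catenoid_t_t (T t th : R) :
  let c := catenoid_scale T in
  partial_vec 2 0 (critical_catenoid T) t th = (c * (cosh t * cos th), c * (cosh t * sin th), 0).
Proof.
  intros c. unfold partial_vec, critical_catenoid, scal3, x1, x2, x3; simpl fst; simpl snd.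
  fold c. apply vec_eq.
  - apply (partial_derive_fst_fst _ (fun t th => c * (sinh t * cos th))
      (fun t th => c * (cosh t * cos th))); derive_explicit.
  - apply (partial_derive_fst_fst _ (fun t th => c * (sinh t * sin th))
      (fun t th => c * (cosh t * sin th))); derive_explicit.
  - apply (partial_derive_fst_fst _ (fun t th => c) (fun t th => 0)); derive_explicit.
Qed.

Lemma catenoid_t_th (T t th : R) :
  let c := catenoid_scale T in
  partial_vec 1 1 (critical_catenoid T) t th
  = (- c * (sinh t * sin th), c * (sinh t * cos th), 0).
Proof.
  intros c. unfold partial_vec, critical_catenoid, scal3, x1, x2, x3; simpl fst; simpl snd.
  fold c. apply vec_eq.
  - apply (partial_derive_fst_snd _ (fun t th => - c * (cosh t * sin th))
      (fun t th => - c * (sinh t * sin th))); derive_explicit.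
  - apply (partial_derive_fst_snd _ (fun t th => c * (cosh t * cos th))
      (fun t th => c * (sinh t * cos th))); derive_explicit.
  - apply (partial_derive_fst_snd _ (fun t th => 0) (fun t th => 0)); derive_explicit.
Qed.

Lemma catenoid_th_th (T t th : R) :
  let c := catenoid_scale T in
  partial_vec 0 2 (critical_catenoid T) t th
  = (- c * (cosh t * cos th), - c * (cosh t * sin th), 0).
Proof.
  intros c. unfold partial_vec, critical_catenoid, scal3, x1, x2, x3; simpl fst; simpl snd.
  fold c. apply vec_eq.
  - apply (partial_derive_snd_snd _ (fun t th => - c * (cosh t * sin th))
      (fun t th => - c * (cosh t * cos th))); derive_explicit.
  - apply (partial_derive_snd_snd _ (fun t th => c * (cosh t * cos th))
      (fun t th => - c * (cosh t * sin th))); derive_explicit.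
  - apply (partial_derive_snd_snd _ (fun t th => 0) (fun t th => 0)); derive_explicit.
Qed.

Lemma sin_sqr (x : R) : sin x ^ 2 = 1 - cos x ^ 2.
Proof. pose proof (sin2_cos2 x) as H. unfold Rsqr in H. lra. Qed.

Lemma sinh_sqr (x : R) : sinh x ^ 2 = cosh x ^ 2 - 1.
Proof. rewrite cosh_sqr. ring. Qed.

Lemma catenoid_metE (T t th : R) :
  metE (critical_catenoid T) t th = catenoid_scale T ^ 2 * cosh t ^ 2.
Proof.
  unfold metE. rewrite catenoid_t. unfold dot, x1, x2, x3; simpl fst; simpl snd.
  ring_simplify. rewrite sin_sqr, sinh_sqr. ring.
Qed.

Lemma catenoid_metF (T t th : R) : metF (critical_catenoid T) t th = 0.
Proof.
  unfold metF. rewrite catenoid_t, catenoid_th. unfold dot, x1, x2, x3; simpl fst; simpl snd.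
  ring.
Qed.

Lemma catenoid_metG (T t th : R) :
  metG (critical_catenoid T) t th = catenoid_scale T ^ 2 * cosh t ^ 2.
Proof.
  unfold metG. rewrite catenoid_th. unfold dot, x1, x2, x3; simpl fst; simpl snd.
  ring_simplify. rewrite sin_sqr. ring.
Qed.

Lemma catenoid_metdet (T t th : R) :
  metdet (critical_catenoid T) t th = (catenoid_scale T ^ 2 * cosh t ^ 2) ^ 2.
Proof. unfold metdet. rewrite catenoid_metE, catenoid_metF, catenoid_metG. ring. Qed.

Lemma catenoid_scale_pos (T : R) : 0 < T -> 0 < catenoid_scale T.
Proof.
  intros HT. apply Rdiv_lt_0_compat; [lra |].
  apply Rmult_lt_0_compat; [easy | apply cosh_pos].
Qed.

Lemma catenoid_density_pos (T t : R) : 0 < T -> 0 < catenoid_scale T ^ 2 * cosh t ^ 2.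
Proof.
  intros HT. apply Rmult_lt_0_compat; apply pow_lt; [now apply catenoid_scale_pos | apply cosh_pos].
Qed.

Lemma catenoid_sqrt_metdet (T t th : R) :
  0 < T -> sqrt (metdet (critical_catenoid T) t th) = catenoid_scale T ^ 2 * cosh t ^ 2.
Proof.
  intros HT. rewrite catenoid_metdet. apply sqrt_pow2.
  apply Rlt_le. now apply catenoid_density_pos.
Qed.

Lemma catenoid_normal (T t th : R) :
  0 < T ->
  unit_normal (critical_catenoid T) t th
  = (- cos th / cosh t, - sin th / cosh t, sinh t / cosh t).
Proof.
  intros HT. pose proof (catenoid_scale_pos T HT) as Hc. pose proof (cosh_pos t) as Hch.
  unfold unit_normal. rewrite catenoid_t, catenoid_th.
  set (c := catenoid_scale T) in *.
  unfold cross, x1, x2, x3; simpl fst; simpl snd.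
  match goal with |- scal3 (/ sqrt ?d) _ = _ => replace d with ((c ^ 2 * cosh t ^ 2) ^ 2) end.
  2: { unfold dot, x1, x2, x3; simpl fst; simpl snd.
       transitivity (c ^ 4 * cosh t ^ 2 * (sin th ^ 2 + cos th ^ 2
         + sinh t ^ 2 * (sin th ^ 2 + cos th ^ 2) ^ 2)); [| ring].
       rewrite sin_sqr, sinh_sqr. ring. }
  rewrite sqrt_pow2.
  2: { apply Rlt_le, (catenoid_density_pos T t HT). }
  unfold scal3, x1, x2, x3; simpl fst; simpl snd. apply vec_eq.
  - field. lra.
  - field. lra.
  - transitivity (sinh t * (sin th ^ 2 + cos th ^ 2) / cosh t); [field; lra |].
    rewrite sin_sqr. field. lra.
Qed.

(** The second fundamental form is diagonal with entries [- c] and [c], over the conformal metric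
    with factor [c ^ 2 * cosh t ^ 2]. The principal curvatures are therefore opposite, of size
    [1 / (c * cosh t ^ 2)]. *)
Lemma catenoid_sff_norm2 (T t th : R) :
  0 < T -> sff_norm2 (critical_catenoid T) t th = 2 / (catenoid_scale T ^ 2 * cosh t ^ 4).
Proof.
  intros HT. pose proof (catenoid_scale_pos T HT) as Hc. pose proof (cosh_pos t) as Hch.
  unfold sff_norm2.
  rewrite catenoid_metE, catenoid_metF, catenoid_metG, catenoid_metdet.
  set (c := catenoid_scale T) in *.
  replace (sff11 (critical_catenoid T) t th) with (- c).
  2: { unfold sff11. rewrite catenoid_normal, catenoid_t_t by easy. fold c.
       unfold dot, x1, x2, x3; simpl fst; simpl snd.
       transitivity (- c * (sin th ^ 2 + cos th ^ 2)); [rewrite sin_sqr; ring | field; lra]. }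
  replace (sff12 (critical_catenoid T) t th) with 0.
  2: { unfold sff12. rewrite catenoid_normal, catenoid_t_th by easy.
       unfold dot, x1, x2, x3; simpl fst; simpl snd. field. lra. }
  replace (sff22 (critical_catenoid T) t th) with c.
  2: { unfold sff22. rewrite catenoid_normal, catenoid_th_th by easy. fold c.
       unfold dot, x1, x2, x3; simpl fst; simpl snd.
       transitivity (c * (sin th ^ 2 + cos th ^ 2)); [rewrite sin_sqr; ring | field; lra]. }
  field. lra.
Qed.

(** In conformal coordinates [E = G = sqrt (det g)] and [F = 0], so each flux is pointwise the plain
    partial derivative of [u]. *)
Lemma jacobi_op_catenoid (T : R) (u : R -> R -> R) (t th : R) :
  0 < T ->
  jacobi_op (critical_catenoid T) u t th
  = (partial_derive 2 0 u t th + partial_derive 0 2 u t th + 2 / cosh t ^ 2 * u t th)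
    / (catenoid_scale T ^ 2 * cosh t ^ 2).
Proof.
  intros HT. pose proof (catenoid_scale_pos T HT) as Hc. pose proof (cosh_pos t) as Hch.
  unfold jacobi_op, laplace_beltrami.
  rewrite catenoid_sqrt_metdet, catenoid_sff_norm2 by easy.
  match goal with |- (partial_derive 1 0 ?f1 t th + partial_derive 0 1 ?f2 t th) / _ + _ = _ =>
    replace (partial_derive 1 0 f1 t th) with (partial_derive 2 0 u t th);
    [replace (partial_derive 0 1 f2 t th) with (partial_derive 0 2 u t th) |] end.
  - field. lra.
  - apply (Derive_ext (fun r => partial_derive 0 1 u t r)). intros r.
    rewrite catenoid_metE, catenoid_metF, catenoid_sqrt_metdet by easy.
    pose proof (catenoid_density_pos T t HT). field.
    split; lra.
  - apply (Derive_ext (fun s => partial_derive 1 0 u s th)). intros s. cbn [Derive_n].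
    rewrite catenoid_metG, catenoid_metF, catenoid_sqrt_metdet by easy.
    pose proof (cosh_pos s). field.
    split; lra.
Qed.

Lemma jacobi_op_zero (T : R) (u : R -> R -> R) (t th : R) :
  0 < T ->
  jacobi_op (critical_catenoid T) u t th = 0 <->
  partial_derive 2 0 u t th + partial_derive 0 2 u t th + 2 / cosh t ^ 2 * u t th = 0.
Proof.
  intros HT. rewrite jacobi_op_catenoid by easy. pose proof (catenoid_density_pos T t HT).
  split; intros E.
  - apply (Rmult_eq_reg_r (/ (catenoid_scale T ^ 2 * cosh t ^ 2))).
    + rewrite Rmult_0_l. exact E.
    + apply Rinv_neq_0_compat. lra.
  - rewrite E. unfold Rdiv. ring.
Qed.

(** The scale is chosen so that [c * cosh T = / T]: a unit step along the conormal changes [t] by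
    [T]. *)
Lemma catenoid_conormal (T : R) (u : R -> R -> R) (b : bool) (th : R) :
  critical_height T ->
  conormal_derivative T u (b, th)
  = (if b then 1 else -1) * (T * partial_derive 1 0 u (bdry_height T b) th).
Proof.
  intros HT. assert (HT0 : 0 < T) by apply HT. pose proof (cosh_pos T) as Hch.
  assert (Hh : cosh (bdry_height T b) = cosh T) by (destruct b; simpl; now rewrite ?cosh_opp).
  unfold conormal_derivative. simpl fst; simpl snd.
  rewrite catenoid_metE, catenoid_metF, catenoid_metG, Hh.
  replace (catenoid_scale T ^ 2 * cosh T ^ 2 - 0 ^ 2 / (catenoid_scale T ^ 2 * cosh T ^ 2))
    with ((/ T) ^ 2) by (unfold catenoid_scale; field; lra).
  rewrite sqrt_pow2 by (apply Rlt_le, Rinv_0_lt_compat; easy).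
  unfold catenoid_scale. field. lra.
Qed.

(** * Separated Jacobi fields and Green's identity *)

(* [auto_derive] leaves derivatives of opaque functions in eta-expanded form. *)
Ltac rewrite_derive H :=
  let E := fresh in
  pose proof (is_derive_unique _ _ _ H) as E;
  match type of E with Derive ?f ?s = ?l =>
    first [rewrite E | replace (Derive (fun z => f z) s) with l by (symmetry; exact E)]
  end; clear E.

(** The derivatives are carried as explicit functions, so that sums, products and solutions of
    linear equations are handled by induction on the order. The result is translated afterwards into
    [ex_derive_n] and [ex_diff_n]. *)
Fixpoint differentiable_upto (n : nat) (f : R -> R) : Prop :=
  match n with
  | O => True
  | S n => exists f', (forall x, is_derive f x (f' x)) /\ differentiable_upto n f'
  end.

Lemma differentiable_upto_pred (n : nat) (f : R -> R) :
  differentiable_upto (S n) f -> differentiable_upto n f.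
Proof.
  revert f; induction n as [|n IH]; intros f; [easy |].
  intros (f' & Hf & Hf'). exists f'. auto.
Qed.

Lemma differentiable_upto_ext (n : nat) (f g : R -> R) :
  (forall x, f x = g x) -> differentiable_upto n f -> differentiable_upto n g.
Proof.
  destruct n as [|n]; [easy |]. intros Hfg (f' & Hf & Hf'). exists f'. split; [| easy].
  intros x. now apply is_derive_ext with f.
Qed.

Lemma differentiable_upto_const (n : nat) (c : R) : differentiable_upto n (fun _ => c).
Proof.
  revert c; induction n as [|n IH]; intros c; [easy |].
  exists (fun _ => 0). split; [intros x; auto_derive; easy | apply IH].
Qed.

Lemma differentiable_upto_plus (n : nat) (f g : R -> R) :
  differentiable_upto n f -> differentiable_upto n g ->
  differentiable_upto n (fun x => f x + g x).
Proof.
  revert f g; induction n as [|n IH]; intros f g; [easy |].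
  intros (f' & Hf & Hf') (g' & Hg & Hg').
  exists (fun x => f' x + g' x). split; [| auto].
  intros x. apply (is_derive_plus f g); auto.
Qed.

Lemma differentiable_upto_mult (n : nat) (f g : R -> R) :
  differentiable_upto n f -> differentiable_upto n g ->
  differentiable_upto n (fun x => f x * g x).
Proof.
  revert f g; induction n as [|n IH]; intros f g; [easy |].
  intros Hf0 Hg0. pose proof (differentiable_upto_pred _ _ Hf0).
  pose proof (differentiable_upto_pred _ _ Hg0).
  destruct Hf0 as (f' & Hf & Hf'), Hg0 as (g' & Hg & Hg').
  exists (fun x => f' x * g x + f x * g' x). split.
  - intros x. apply (is_derive_mult f g); auto. intros; apply Rmult_comm.
  - apply differentiable_upto_plus; auto.
Qed.

(* Bootstrapping: solutions of [f'' = q f] inherit their regularity from [q]. *)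
Lemma differentiable_upto_linear_ode (q f f' : R -> R) :
  (forall n, differentiable_upto n q) ->
  (forall x, is_derive f x (f' x)) -> (forall x, is_derive f' x (q x * f x)) ->
  forall n, differentiable_upto n f /\ differentiable_upto n f'.
Proof.
  intros Hq Hf Hf' n. induction n as [|n [IH1 IH2]]; [easy |]. split.
  - now exists f'.
  - exists (fun x => q x * f x). split; [easy | now apply differentiable_upto_mult].
Qed.

Lemma differentiable_upto_sinh (n : nat) : differentiable_upto n sinh.
Proof.
  apply (differentiable_upto_linear_ode (fun _ => 1) sinh cosh); intros.
  - apply differentiable_upto_const.
  - derive_explicit.
  - derive_explicit.
Qed.

Lemma differentiable_upto_inv_cosh (n : nat) : differentiable_upto n (fun x => / cosh x).
Proof.
  induction n as [|n IH]; [easy |].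
  exists (fun x => -1 * (sinh x * (/ cosh x * / cosh x))). split.
  - intros x. auto_derive; [apply cosh_neq_0 | field; apply cosh_neq_0].
  - apply differentiable_upto_mult; [apply differentiable_upto_const |].
    apply differentiable_upto_mult; [apply differentiable_upto_sinh |].
    now apply differentiable_upto_mult.
Qed.

Definition jacobi_mode (k : R) (g g' : R -> R) : Prop :=
  (forall t, is_derive g t (g' t)) /\
  (forall t, is_derive g' t ((k ^ 2 - 2 / cosh t ^ 2) * g t)).

Definition harmonic (k : R) (p p' : R -> R) : Prop :=
  (forall th, is_derive p th (p' th)) /\ (forall th, is_derive p' th (- k ^ 2 * p th)).

Lemma jacobi_mode_differentiable (k : R) (g g' : R -> R) (n : nat) :
  jacobi_mode k g g' -> differentiable_upto n g.
Proof.
  intros [Hg Hg'].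
  apply (differentiable_upto_linear_ode (fun t => k ^ 2 - 2 / cosh t ^ 2) g g'); auto.
  intros m. apply differentiable_upto_ext with
    (fun t => k ^ 2 + -2 * (/ cosh t * / cosh t)).
  - intros t. field. apply cosh_neq_0.
  - apply differentiable_upto_plus; [apply differentiable_upto_const |].
    apply differentiable_upto_mult; [apply differentiable_upto_const |].
    apply differentiable_upto_mult; apply differentiable_upto_inv_cosh.
Qed.

Lemma harmonic_differentiable (k : R) (p p' : R -> R) (n : nat) :
  harmonic k p p' -> differentiable_upto n p.
Proof.
  intros [Hp Hp'].
  apply (differentiable_upto_linear_ode (fun t => - k ^ 2) p p'); auto.
  intros m. apply differentiable_upto_const.
Qed.

Lemma differentiable_upto_ex_derive_n (n : nat) (f : R -> R) (x : R) :
  differentiable_upto n f -> ex_derive_n f n x.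
Proof.
  destruct n as [|n]; [easy |]. revert f x.
  induction n as [|n IH]; intros f x (f' & Hf & Hf').
  - exists (f' x). apply Hf.
  (* [Derive_n] adds derivatives on the outside, whereas [differentiable_upto] strips the innermost
     one; the two orders are reconciled here. *)
  - apply (ex_derive_ext (Derive_n f' n)); [| now apply (IH f')].
    intros t. clear - Hf. revert t. induction n as [|n IH]; intros t.
    + symmetry. apply is_derive_unique, Hf.
    + simpl. apply Derive_ext. intros s. apply IH.
Qed.

(** One order is spent on continuity: [ex_diff_n] asks that the top derivatives be jointly
    continuous, which is obtained from their differentiability. *)
Lemma ex_diff_n_product (n : nat) (f g : R -> R) (t th : R) :
  differentiable_upto (S n) f -> differentiable_upto (S n) g ->
  ex_diff_n (fun t th => f t * g th) n t th.
Proof.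
  revert f g t th. induction n as [|n IH]; intros f g t th Hf0 Hg0.
  - destruct Hf0 as (f' & Hf & _), Hg0 as (g' & Hg & _). split; [| easy].
    apply continuity_2d_pt_mult; apply continuity_1d_2d_pt_comp.
    + apply derivable_continuous_pt. exists (f' t). apply is_derive_Reals, Hf.
    + apply continuity_2d_pt_id1.
    + apply derivable_continuous_pt. exists (g' th). apply is_derive_Reals, Hg.
    + apply continuity_2d_pt_id2.
  - pose proof (differentiable_upto_pred _ _ Hf0) as Hf1.
    pose proof (differentiable_upto_pred _ _ Hg0) as Hg1.
    assert (Hc : continuity_2d_pt (fun t th => f t * g th) t th).
    { specialize (IH f g t th Hf1 Hg1). destruct n; apply IH. }
    destruct Hf0 as (f' & Hf & Hf'), Hg0 as (g' & Hg & Hg').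
    assert (Ht : forall s r, is_derive (fun z => f z * g r) s (f' s * g r)).
    { intros s r. auto_derive; [now exists (f' s) |].
      rewrite_derive (Hf s). ring. }
    assert (Hth : forall s r, is_derive (fun z => f s * g z) r (f s * g' r)).
    { intros s r. auto_derive; [now exists (g' r) |].
      rewrite_derive (Hg r). ring. }
    split; [easy |]. repeat split.
    + eexists; apply Ht.
    + eexists; apply Hth.
    + apply (ex_diff_n_ext_loc (fun s r => f' s * g r)); [| now apply IH].
      exists (mkposreal 1 Rlt_0_1). intros s r _ _. symmetry. apply is_derive_unique, Ht.
    + apply (ex_diff_n_ext_loc (fun s r => f s * g' r)); [| now apply IH].
      exists (mkposreal 1 Rlt_0_1). intros s r _ _. symmetry. apply is_derive_unique, Hth.
Qed.

Lemma separated_eigenfunction (T delta k : R) (g g' p p' : R -> R) :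
  critical_height T -> jacobi_mode k g g' -> harmonic k p p' ->
  (forall th, p (th + 2 * PI) = p th) ->
  T * g' T = delta * g T -> - T * g' (- T) = delta * g (- T) ->
  eigenspace T delta (fun q => g (bdry_height T (fst q)) * p (snd q)).
Proof.
  intros HT Hg Hp Hper Hplus Hminus.
  assert (Ht : forall s r, is_derive (fun z => g z * p r) s (g' s * p r)).
  { intros s r. auto_derive; [exists (g' s); apply Hg |].
    rewrite_derive (proj1 Hg s). ring. }
  split; [split |].
  - intros b n th. apply differentiable_upto_ex_derive_n.
    apply (differentiable_upto_mult n (fun _ => g (bdry_height T b)) p).
    + apply differentiable_upto_const.
    + now apply (harmonic_differentiable k p p').
  - intros b th. simpl. now rewrite Hper.
  - exists (fun t th => g t * p th). split; [split; [split | split] |].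
    + intros n t th. apply ex_diff_n_product.
      * now apply (jacobi_mode_differentiable k g g').
      * now apply (harmonic_differentiable k p p').
    + intros t th. now rewrite Hper.
    + intros t th _. apply jacobi_op_zero; [apply HT |].
      rewrite (partial_derive_fst_fst _ (fun t th => g' t * p th)
        (fun t th => (k ^ 2 - 2 / cosh t ^ 2) * g t * p th)).
      * rewrite (partial_derive_snd_snd _ (fun t th => g t * p' th)
          (fun t th => g t * (- k ^ 2 * p th))).
        -- field. apply cosh_neq_0.
        -- intros r. auto_derive; [exists (p' r); apply Hp |].
           rewrite_derive (proj1 Hp r). ring.
        -- intros r. auto_derive; [eexists; apply Hp |].
           rewrite_derive (proj2 Hp r). ring.
      * intros s. apply Ht.
      * intros s. auto_derive; [eexists; apply Hg |].
        rewrite_derive (proj2 Hg s). ring.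
    + easy.
    + intros [b th]. rewrite catenoid_conormal by easy.
      rewrite (partial_derive_fst _ (fun t th => g' t * p th)) by (intros; apply Ht).
      destruct b; simpl.
      * transitivity (T * g' T * p th); [ring | rewrite Hplus; ring].
      * transitivity (- T * g' (- T) * p th); [ring | rewrite Hminus; ring].
Qed.

(** * Fourier coefficients of the extension and their mode equation *)

Definition smooth_plane (u : R -> R -> R) : Prop := forall n t th, ex_diff_n u n t th.

Lemma smooth_plane_t (u : R -> R -> R) :
  smooth_plane u -> smooth_plane (fun t th => Derive (fun z => u z th) t).
Proof. intros Hu n t th. apply (Hu (S n) t th). Qed.

Lemma smooth_plane_th (u : R -> R -> R) :
  smooth_plane u -> smooth_plane (fun t th => Derive (fun z => u t z) th).
Proof. intros Hu n t th. apply (Hu (S n) t th). Qed.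

Lemma smooth_plane_is_derive_t (u : R -> R -> R) (t th : R) :
  smooth_plane u -> is_derive (fun z => u z th) t (Derive (fun z => u z th) t).
Proof. intros Hu. apply Derive_correct. apply (Hu 1%nat t th). Qed.

Lemma smooth_plane_is_derive_th (u : R -> R -> R) (t th : R) :
  smooth_plane u -> is_derive (fun z => u t z) th (Derive (fun z => u t z) th).
Proof. intros Hu. apply Derive_correct. apply (Hu 1%nat t th). Qed.

Lemma smooth_plane_continuous (u : R -> R -> R) (t th : R) :
  smooth_plane u -> continuous (fun z => u t z) th.
Proof.
  intros Hu. apply (ex_derive_continuous (K := R_AbsRing) (V := R_NormedModule)).
  apply (Hu 1%nat t th).
Qed.

Lemma cos_coef_ext (f g : R -> R) (n : nat) (x : R) :
  (forall s, f s = g s) -> cos_coef f n x = cos_coef g n x.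
Proof. intros H. apply RInt_Rext. intros s. now rewrite H. Qed.

Lemma cos_coef_is_derive (u : R -> R -> R) (n : nat) (x t : R) :
  smooth_plane u ->
  is_derive (fun t => cos_coef (u t) n x) t
    (cos_coef (fun s => Derive (fun z => u z s) t) n x).
Proof.
  intros Hu. unfold cos_coef.
  set (p := fun s => cos (INR n * (s - x))).
  assert (Hp : forall s, continuous p s) by (intros s; unfold p; continuity_explicit).
  assert (Hd : forall z s, is_derive (fun z => u z s * p s) z (Derive (fun z => u z s) z * p s)).
  { intros z s. pose proof (smooth_plane_is_derive_t u z s Hu) as H.
    auto_derive; [now eexists; apply H | ring]. }
  rewrite (RInt_Rext _ (fun s => Derive (fun z => u z s * p s) t)).
  2: { intros s. symmetry. apply is_derive_unique, Hd. }
  apply (is_derive_RInt_param (fun t s => u t s * p s)).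
  - exists (mkposreal 1 Rlt_0_1). intros z _ s _. eexists; apply Hd.
  - intros s _. apply continuity_2d_pt_ext with
      (fun z r => Derive (fun z => u z r) z * p r).
    + intros z r. symmetry. apply is_derive_unique, Hd.
    + apply continuity_2d_pt_mult.
      * apply (smooth_plane_t u Hu 0%nat).
      * apply (continuity_1d_2d_pt_comp p (fun _ r => r)); [| apply continuity_2d_pt_id2].
        apply continuity_pt_filterlim, Hp.
  - exists (mkposreal 1 Rlt_0_1). intros z _. apply cos_coef_ex.
    intros s. now apply smooth_plane_continuous.
Qed.

Lemma periodic_derive (f f' : R -> R) (c : R) :
  (forall s, is_derive f s (f' s)) -> (forall s, f (s + c) = f s) ->
  forall s, f' (s + c) = f' s.
Proof.
  intros Hd Hf s.
  rewrite <- (is_derive_unique f s (f' s)) by apply Hd.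
  symmetry. apply is_derive_unique.
  apply (is_derive_ext (fun s => f (s + c))); [easy |].
  auto_derive; [eexists; apply Hd |].
  rewrite_derive (Hd (s + c)). ring.
Qed.

(** Two integrations by parts: one boundary term carries [sin (n PI) = 0], the other cancels because
    [f'] is periodic. *)
Lemma cos_coef_second_derivative (f f' f'' : R -> R) (n : nat) (x : R) :
  (forall s, is_derive f s (f' s)) -> (forall s, is_derive f' s (f'' s)) ->
  (forall s, continuous f'' s) -> (forall s, f (s + 2 * PI) = f s) ->
  cos_coef f'' n x = - INR n ^ 2 * cos_coef f n x.
Proof.
  intros Hf Hf' Hc Hper.
  pose proof (periodic_derive f f' (2 * PI) Hf Hper) as Hper'.
  assert (Hcf : forall s, continuous f s).
  { intros s. apply (ex_derive_continuous (K := R_AbsRing) (V := R_NormedModule)).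
    eexists; apply Hf. }
  enough (cos_coef (fun s => 1 * f'' s + INR n ^ 2 * f s) n x = 0) as H.
  { rewrite cos_coef_lin in H by easy. lra. }
  unfold cos_coef.
  rewrite (RInt_derivative (fun s => f' s * cos (INR n * (s - x))
     + f s * (INR n * sin (INR n * (s - x))))).
  - assert (Hs : sin (INR n * PI) = 0).
    { apply sin_eq_0_1. exists (Z.of_nat n). now rewrite <- INR_IZR_INZ. }
    replace (x + PI - x) with PI by ring. replace (x - PI - x) with (- PI) by ring.
    rewrite <- !Ropp_mult_distr_r, sin_neg, cos_neg, Hs.
    replace (x + PI) with (x - PI + 2 * PI) by ring. rewrite Hper'. ring.
  - intros s. auto_derive; [repeat split; eexists; [apply Hf' | apply Hf] |].
    rewrite_derive (Hf s). rewrite_derive (Hf' s).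
    unfold Rminus. ring.
  - intros s. apply continuous_Rmult; [| continuity_explicit].
    apply continuous_Rplus; apply continuous_Rmult; auto using continuous_const.
Qed.

(* Green's identity between the extension [u] and the Jacobi field
   [g t * cos (n (th - x))]: their Wronskian, integrated over a circle
   [t = const], does not depend on [t]. *)
Lemma green_identity (T delta : R) (h : bdry -> R) (n : nat) (x : R) (g g' : R -> R) :
  critical_height T -> eigenspace T delta h -> jacobi_mode (INR n) g g' ->
  (delta * g T - T * g' T) * cos_coef (fun s => h (true, s)) n x
  + (delta * g (- T) + T * g' (- T)) * cos_coef (fun s => h (false, s)) n x = 0.
Proof.
  intros HT [_ (u & ((Hu & Hper) & HJ & Hb) & Hn)] [Hg Hg'].
  assert (HT0 : 0 < T) by apply HT.
  set (a := fun t => cos_coef (u t) n x).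
  set (a1 := fun t => cos_coef (fun s => Derive (fun z => u z s) t) n x).
  set (ut := fun t s => Derive (fun z => u z s) t).
  assert (Hut : smooth_plane ut) by apply (smooth_plane_t u Hu).
  assert (Ha : forall t, is_derive a t (a1 t)) by (intros; now apply cos_coef_is_derive).
  (* Confined to the strip, because outside it [u] is an arbitrary smooth extension and need not
     satisfy the Jacobi equation. *)
  assert (Ha1 : forall t, - T <= t <= T ->
    is_derive a1 t ((INR n ^ 2 - 2 / cosh t ^ 2) * a t)).
  { intros t Ht.
    pose proof (smooth_plane_th u Hu) as Huth.
    replace ((INR n ^ 2 - 2 / cosh t ^ 2) * a t)
      with (cos_coef (fun s => Derive (fun z => ut z s) t) n x);
      [now apply (cos_coef_is_derive ut) |].
    set (uth := fun s => Derive (fun z => u t z) s).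
    set (uthth := fun s => Derive uth s).
    assert (Hc : forall s, continuous uthth s).
    { intros s. apply (smooth_plane_continuous
        (fun t s => Derive (fun z => Derive (fun y => u t y) z) s) t s).
      exact (smooth_plane_th _ Huth). }
    rewrite (cos_coef_ext _ (fun s => (-1) * uthth s + (- (2 / cosh t ^ 2)) * u t s)).
    - rewrite cos_coef_lin by (try easy; intros; now apply smooth_plane_continuous).
      rewrite (cos_coef_second_derivative (u t) uth uthth).
      + unfold a. ring.
      + intros s. now apply smooth_plane_is_derive_th.
      + intros s. apply (smooth_plane_is_derive_th (fun t z => Derive (fun y => u t y) z)).
        exact Huth.
      + easy.
      + intros s. apply Hper.
    - intros s. pose proof (HJ t s Ht) as H. apply jacobi_op_zero in H; [| easy].
      change (partial_derive 2 0 u t s) with (Derive (fun z => ut z s) t) in H.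
      change (partial_derive 0 2 u t s) with (uthth s) in H. lra. }
  set (W := fun t => a1 t * g t - a t * g' t).
  assert (HW : W (- T) = W T).
  { apply (eq_is_derive W); [| lra]. intros t Ht.
    unfold W. auto_derive.
    - repeat split; eexists; [now apply Ha1 | apply Hg | apply Ha | apply Hg'].
    - rewrite_derive (Ha1 t Ht). rewrite_derive (Ha t).
      rewrite_derive (Hg t). rewrite_derive (Hg' t).
      unfold zero; simpl. ring. }
  (* Passes a pointwise Steklov condition on one boundary circle to its coefficients. The summands
     with factor 0 bring both sides into the form of [cos_coef_lin]. *)
  assert (Hconst : forall t c d v, (forall s, d * ut t s = c * v s) ->
    (forall s, v s = u t s) -> d * a1 t = c * cos_coef v n x).
  { intros t c d v E Ev.
    transitivity (cos_coef (fun s => d * ut t s + 0 * ut t s) n x).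
    - rewrite cos_coef_lin by (intros; now apply smooth_plane_continuous).
      unfold a1, ut. ring.
    - rewrite (cos_coef_ext _ (fun s => c * v s + 0 * v s)).
      + rewrite cos_coef_lin; [ring | |];
          intros s; apply (continuous_ext (u t)); try (intros; now rewrite Ev);
          now apply smooth_plane_continuous.
      + intros s. rewrite E. ring. }
  pose proof (Hconst T delta T (fun s => h (true, s))) as Hp.
  pose proof (Hconst (- T) delta (- T) (fun s => h (false, s))) as Hm.
  assert (Ea : a T = cos_coef (fun s => h (true, s)) n x).
  { apply cos_coef_ext. intros s. apply (Hb true). }
  assert (Eb : a (- T) = cos_coef (fun s => h (false, s)) n x).
  { apply cos_coef_ext. intros s. apply (Hb false). }
  rewrite <- Ea in Hp |- *. rewrite <- Eb in Hm |- *.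
  assert (T * a1 T = delta * a T) as Hp'.
  { apply Hp; intros s; [| symmetry; apply (Hb true)].
    pose proof (Hn (true, s)) as E. rewrite catenoid_conormal in E by easy.
    rewrite <- E. simpl. unfold ut. unfold partial_derive; simpl. ring. }
  assert (- T * a1 (- T) = delta * a (- T)) as Hm'.
  { apply Hm; intros s; [| symmetry; apply (Hb false)].
    pose proof (Hn (false, s)) as E. rewrite catenoid_conormal in E by easy.
    rewrite <- E. simpl. unfold ut. unfold partial_derive; simpl. ring. }
  unfold W in HW.
  replace (_ + _) with ((delta * a T) * g T - T * (a T * g' T)
    + ((delta * a (- T)) * g (- T) + T * (a (- T) * g' (- T)))) by ring.
  rewrite <- Hp', <- Hm'.
  replace (_ + _) with (T * ((a1 T * g T - a T * g' T)
    - (a1 (- T) * g (- T) - a (- T) * g' (- T)))) by ring.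
  rewrite HW. ring.
Qed.

(** * Explicit solutions of the mode equation *)

(** Darboux transformation: the operator [d/dt - tanh t] maps solutions of [y'' = k ^ 2 y] to
    solutions of the mode equation. This is the image of [sinh (k t)], and [odd_mode] is the image
    of [cosh (k t)]. For [k = 1] the latter degenerates, since [cosh] spans the kernel of the
    operator. *)
Definition even_mode (k t : R) : R := k * cosh (k * t) - sinh t / cosh t * sinh (k * t).
Definition even_mode' (k t : R) : R :=
  (k ^ 2 - 1 / cosh t ^ 2) * sinh (k * t) - k * (sinh t / cosh t) * cosh (k * t).
Definition odd_mode (k t : R) : R := k * sinh (k * t) - sinh t / cosh t * cosh (k * t).
Definition odd_mode' (k t : R) : R :=
  (k ^ 2 - 1 / cosh t ^ 2) * cosh (k * t) - k * (sinh t / cosh t) * sinh (k * t).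

(* [even_mode 0] and [odd_mode 1] vanish identically; these are the missing solutions. *)
Definition even_mode_0 (t : R) : R := 1 - t * (sinh t / cosh t).
Definition even_mode_0' (t : R) : R := - (sinh t / cosh t) - t / cosh t ^ 2.
Definition odd_mode_1 (t : R) : R := sinh t + t / cosh t.
Definition odd_mode_1' (t : R) : R := cosh t + 1 / cosh t - t * sinh t / cosh t ^ 2.

Ltac solve_mode :=
  split; intros t; pose proof (cosh_neq_0 t); pose proof (sinh_sqr t) as E;
  (auto_derive; [
    repeat split; rewrite ?Rmult_1_r; auto using Rmult_integral_contrapositive_currified
  | field_simplify_eq; [ring [E] | trivial]]).

Lemma even_mode_jacobi (k : R) : jacobi_mode k (even_mode k) (even_mode' k).
Proof. unfold even_mode, even_mode'. solve_mode. Qed.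

Lemma odd_mode_jacobi (k : R) : jacobi_mode k (odd_mode k) (odd_mode' k).
Proof. unfold odd_mode, odd_mode'. solve_mode. Qed.

(** For [k = 0] the second solution of [y'' = 0] is [t], and [even_mode_0] is its Darboux image. Up
    to a constant factor it is the support function of the catenoid, the Jacobi field of
    dilations. *)
Lemma even_mode_0_jacobi : jacobi_mode 0 even_mode_0 even_mode_0'.
Proof. unfold even_mode_0, even_mode_0'. solve_mode. Qed.

(** Found by reduction of order: [even_mode 1] is [1 / cosh], and [odd_mode_1] is twice [1 / cosh]
    times the integral of [cosh ^ 2] from 0. It is the radial profile of the rotations about
    horizontal axes. *)
Lemma odd_mode_1_jacobi : jacobi_mode 1 odd_mode_1 odd_mode_1'.
Proof. unfold odd_mode_1, odd_mode_1'. solve_mode. Qed.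

Definition has_parity (sg : R) (g g' : R -> R) : Prop :=
  forall t, g (- t) = sg * g t /\ g' (- t) = - sg * g' t.

Ltac solve_parity :=
  intros t; rewrite <- ?Ropp_mult_distr_r, ?cosh_opp, ?sinh_opp;
  pose proof (cosh_neq_0 t); split; now field.

Lemma even_mode_parity (k : R) : has_parity 1 (even_mode k) (even_mode' k).
Proof. unfold even_mode, even_mode'. solve_parity. Qed.

Lemma odd_mode_parity (k : R) : has_parity (-1) (odd_mode k) (odd_mode' k).
Proof. unfold odd_mode, odd_mode'. solve_parity. Qed.

Lemma even_mode_0_parity : has_parity 1 even_mode_0 even_mode_0'.
Proof. unfold even_mode_0, even_mode_0'. solve_parity. Qed.

Lemma odd_mode_1_parity : has_parity (-1) odd_mode_1 odd_mode_1'.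
Proof. unfold odd_mode_1, odd_mode_1'. solve_parity. Qed.

Lemma critical_tanh (T : R) : critical_height T -> sinh T / cosh T = / T.
Proof.
  intros HT. rewrite (critical_cosh T HT). pose proof (critical_sinh_pos T HT).
  destruct HT. field. lra.
Qed.

Lemma critical_inv_cosh_sqr (T : R) : critical_height T -> 1 / cosh T ^ 2 = 1 - 1 / T ^ 2.
Proof.
  intros HT. pose proof (inv_sinh_sqr T HT) as E. pose proof (critical_sinh_pos T HT).
  assert (0 < T) by apply HT.
  rewrite (critical_cosh T HT).
  transitivity (1 / sinh T ^ 2 / T ^ 2); [field; lra | rewrite E; field; lra].
Qed.

Lemma even_mode_boundary (T k : R) : critical_height T ->
  even_mode k T = k * cosh (k * T) - sinh (k * T) / T /\
  T * even_mode' k T = T * (k ^ 2 - 1) * sinh (k * T) + sinh (k * T) / T - k * cosh (k * T).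
Proof.
  intros HT. assert (0 < T) by apply HT. unfold even_mode, even_mode'.
  rewrite critical_tanh, critical_inv_cosh_sqr by easy. split; field; lra.
Qed.

Lemma odd_mode_boundary (T k : R) : critical_height T ->
  odd_mode k T = k * sinh (k * T) - cosh (k * T) / T /\
  T * odd_mode' k T = T * (k ^ 2 - 1) * cosh (k * T) + cosh (k * T) / T - k * sinh (k * T).
Proof.
  intros HT. assert (0 < T) by apply HT. unfold odd_mode, odd_mode'.
  rewrite critical_tanh, critical_inv_cosh_sqr by easy. split; field; lra.
Qed.

(** The free boundary condition makes the position vector tangent to the surface along the boundary,
    so the support function vanishes there. Its nonzero conormal derivative expresses the
    admissibility constraint on [h]. *)
Lemma even_mode_0_boundary (T : R) : critical_height T ->
  even_mode_0 T = 0 /\ even_mode_0' T <> 0.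
Proof.
  intros HT. assert (0 < T) by apply HT. unfold even_mode_0, even_mode_0'.
  assert (E : T / cosh T ^ 2 = T * (1 - 1 / T ^ 2)).
  { rewrite <- critical_inv_cosh_sqr by easy. field. apply cosh_neq_0. }
  rewrite E, critical_tanh by easy. split; [field; lra |].
  replace (- / T - T * (1 - 1 / T ^ 2)) with (- T) by (field; lra). lra.
Qed.

(** Rotations preserve the ball and hence the free boundary condition, whose linearisation in the
    unit ball is the Robin condition with constant 1. *)
Lemma odd_mode_1_boundary (T : R) : critical_height T ->
  0 < odd_mode_1 T /\ T * odd_mode_1' T = odd_mode_1 T.
Proof.
  intros HT. assert (HT0 : 0 < T) by apply HT. pose proof (critical_sinh_pos T HT) as Hs.
  pose proof (cosh_pos T) as Hc.
  unfold odd_mode_1, odd_mode_1'. split.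
  - apply Rplus_lt_0_compat; [easy | now apply Rdiv_lt_0_compat].
  - pose proof (critical_sinh_sqr T HT) as E. rewrite (critical_cosh T HT) in *.
    assert (E' : T ^ 2 * sinh T ^ 2 = sinh T ^ 2 + 1) by lra.
    apply (Rmult_eq_reg_r (sinh T)); [| lra].
    transitivity (T ^ 2 * sinh T ^ 2); [field; lra |].
    transitivity (sinh T ^ 2 + 1); [easy | field; lra].
Qed.

Lemma sinh_lt_cosh (x : R) : sinh x < cosh x.
Proof. unfold sinh, cosh. pose proof (exp_pos (- x)). lra. Qed.

(** The quotient bound amounts to [3 k T C <= (T ^ 2 (k ^ 2 - 1) + 3) S]. Inserting the lower bound
    for [S / C] from [tanh_mode_lower] leaves [T C (k - 2) (T ^ 2 (2 k + 1) - 3) >= 0], clear from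
    [T > 1] and [k >= 2]. *)
Lemma even_mode_steklov (T k : R) : critical_height T -> 2 <= k ->
  0 < even_mode k T /\ 2 * even_mode k T <= T * even_mode' k T.
Proof.
  intros HT Hk. pose proof (critical_height_gt_1 T HT) as HT1.
  pose proof (tanh_mode_lower T k HT Hk) as Hl.
  destruct (even_mode_boundary T k HT) as [-> ->].
  pose proof (sinh_lt_cosh (k * T)) as Hlt. pose proof (cosh_pos (k * T)) as HC.
  set (C := cosh (k * T)) in *. set (S := sinh (k * T)) in *.
  assert (HS : 0 < S) by (unfold S; rewrite <- sinh_0; apply sinh_lt; nra).
  split.
  - assert (S / T < S).
    { apply (Rmult_lt_reg_r T); [lra |]. unfold Rdiv.
      rewrite Rmult_assoc, Rinv_l by lra. nra. }
    nra.
  - enough (0 <= (T ^ 2 * (k ^ 2 - 1) + 3) * S - 3 * k * T * C) as H.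
    { apply (Rmult_le_reg_r T); [lra |].
      enough (T * (k ^ 2 - 1) * S * T + S - k * C * T - 2 * (k * C * T - S) >= 0) as H'.
      { replace (2 * (k * C - S / T) * T) with (2 * (k * C * T - S)) by (field; lra).
        replace ((T * (k ^ 2 - 1) * S + S / T - k * C) * T)
          with (T * (k ^ 2 - 1) * S * T + S - k * C * T) by (field; lra). lra. }
      lra. }
    assert (HT2 : 1 < T ^ 2) by nra.
    assert (Hp : 0 <= T ^ 2 * (k ^ 2 - 1) + 3).
    { assert (0 <= T ^ 2 * (k ^ 2 - 1)) by (apply Rmult_le_pos; nra). lra. }
    apply (Rmult_le_compat_l _ _ _ Hp) in Hl.
    assert (Hq : 0 <= T * C * ((k - 2) * (T ^ 2 * (2 * k + 1) - 3))).
    { apply Rmult_le_pos; [nra |]. apply Rmult_le_pos; nra. }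
    apply (Rmult_le_reg_l (T ^ 2 + 1)); [nra |]. lra.
Qed.

(** The boundary values are those of the even mode with [C] and [S] exchanged. The slack in the
    bound thus exceeds the even one by a nonnegative multiple of [C - S], and the even case gives
    the claim. *)
Lemma odd_mode_steklov (T k : R) : critical_height T -> 2 <= k ->
  0 < odd_mode k T /\ 2 * odd_mode k T <= T * odd_mode' k T.
Proof.
  intros HT Hk. pose proof (critical_height_gt_1 T HT) as HT1.
  destruct (even_mode_steklov T k HT Hk) as [_ He].
  pose proof (tanh_mode_lower T k HT Hk) as Hl.
  destruct (even_mode_boundary T k HT) as [E1 E2]. rewrite E1, E2 in He.
  destruct (odd_mode_boundary T k HT) as [-> ->].
  pose proof (sinh_lt_cosh (k * T)) as Hlt. pose proof (cosh_pos (k * T)) as HC.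
  set (C := cosh (k * T)) in *. set (S := sinh (k * T)) in *.
  split.
  - apply (Rmult_lt_reg_r (T * (T ^ 2 + 1))); [nra |].
    replace ((k * S - C / T) * (T * (T ^ 2 + 1)))
      with (k * T * ((T ^ 2 + 1) * S) - C * (T ^ 2 + 1)) by (field; lra).
    apply (Rmult_le_compat_l (k * T)) in Hl; [| nra].
    assert (0 < C * (2 * k * T ^ 2 - T ^ 2 - 1)) by (apply Rmult_lt_0_compat; nra).
    lra.
  - assert (Hi : 0 < / T) by (apply Rinv_0_lt_compat; lra).
    unfold Rdiv in *.
    assert (0 <= (T * (k ^ 2 - 1) + 3 * / T + 3 * k) * (C - S)).
    { apply Rmult_le_pos; [| lra]. assert (0 <= T * (k ^ 2 - 1)) by (apply Rmult_le_pos; nra).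
      lra. }
    lra.
Qed.

(** Both inequalities behind [even_mode_steklov] are equalities at [k = 2], because [tanh T = 1 / T]
    gives [tanh (2 T) = 2 T / (T ^ 2 + 1)]. *)
Lemma even_mode_2_boundary (T : R) : critical_height T ->
  T * even_mode' 2 T = 2 * even_mode 2 T.
Proof.
  intros HT. assert (HT0 : 0 < T) by apply HT.
  destruct (even_mode_boundary T 2 HT) as [-> ->].
  replace (2 * T) with (T + T) by ring. rewrite cosh_plus, sinh_plus, (critical_cosh T HT).
  field. lra.
Qed.

(** * The spectrum below 2 *)

(** Written with the factor 1 to match [cos_coef_lin]. For [sg] equal to 1 or -1 it is twice the
    even or odd part of [h] under exchange of the circles. *)
Definition parity_part (sg : R) (h : bdry -> R) (s : R) : R :=
  1 * h (true, s) + sg * h (false, s).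

Lemma smooth_bdry_continuous (h : bdry -> R) (b : bool) (s : R) :
  smooth_bdry_fun h -> continuous (fun r => h (b, r)) s.
Proof.
  intros [Hd _]. apply (ex_derive_continuous (K := R_AbsRing) (V := R_NormedModule)).
  apply (Hd b 1%nat s).
Qed.

Lemma parity_part_continuous (sg : R) (h : bdry -> R) (s : R) :
  smooth_bdry_fun h -> continuous (parity_part sg h) s.
Proof.
  intros Hh. apply continuous_Rplus; apply continuous_Rmult;
    auto using continuous_const, smooth_bdry_continuous.
Qed.

Lemma parity_part_period (sg : R) (h : bdry -> R) (s : R) :
  smooth_bdry_fun h -> parity_part sg h (s + 2 * PI) = parity_part sg h s.
Proof. intros [_ Hp]. unfold parity_part. now rewrite !Hp. Qed.

(** The condition compares products instead of the quotient [T g' / g], so that it also covers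
    [even_mode_0], for which [g T = 0]. *)
Lemma parity_coef_zero (T delta sg : R) (h : bdry -> R) (n : nat) (x : R) (g g' : R -> R) :
  critical_height T -> eigenspace T delta h -> jacobi_mode (INR n) g g' ->
  has_parity sg g g' -> T * g' T <> delta * g T -> cos_coef (parity_part sg h) n x = 0.
Proof.
  intros HT Hh Hg Hsg Hne.
  pose proof (green_identity T delta h n x g g' HT Hh Hg) as H.
  destruct (Hsg T) as [E1 E2]. rewrite E1, E2 in H.
  destruct Hh as [Hh _].
  unfold parity_part. rewrite (cos_coef_lin (fun s => h (true, s)) (fun s => h (false, s)))
    by (intros; now apply smooth_bdry_continuous).
  apply (Rmult_eq_reg_l (delta * g T - T * g' T)); lra.
Qed.

Lemma even_coef_zero (T delta : R) (h : bdry -> R) (n : nat) (x : R) :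
  critical_height T -> eigenspace T delta h -> delta < 2 ->
  n <> 1%nat \/ delta <> - 1 -> cos_coef (parity_part 1 h) n x = 0.
Proof.
  intros HT Hh Hd. pose proof (critical_height_gt_1 T HT) as HT1.
  destruct n as [|[|n]].
  - intros _. apply (parity_coef_zero T delta 1 h 0 x even_mode_0 even_mode_0');
      auto using even_mode_0_jacobi, even_mode_0_parity.
    (* With [g T = 0] the condition no longer depends on [delta]: the rotationally symmetric even
       part of [h] is excluded for every [delta]. *)
    destruct (even_mode_0_boundary T HT) as [-> Hne]. rewrite Rmult_0_r.
    apply Rmult_integral_contrapositive_currified; [lra | easy].
  - intros [H | H]; [easy |].
    apply (parity_coef_zero T delta 1 h 1 x (even_mode 1) (even_mode' 1));
      auto using even_mode_jacobi, even_mode_parity.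
    destruct (even_mode_boundary T 1 HT) as [E ->]. rewrite E.
    rewrite !Rmult_1_l, (critical_cosh T HT).
    pose proof (critical_sinh_pos T HT). pose proof (critical_sinh_sqr T HT).
    intros Heq. apply H.
    assert (Hq : 0 < T * sinh T - sinh T / T).
    { replace (T * sinh T - sinh T / T) with (sinh T * (T ^ 2 - 1) / T) by (field; lra).
      apply Rdiv_lt_0_compat; nra. }
    apply (Rmult_eq_reg_r (T * sinh T - sinh T / T)); lra.
  - intros _.
    assert (Hlarge : 2 <= INR (S (S n))) by (rewrite !S_INR; pose proof (pos_INR n); lra).
    apply (parity_coef_zero T delta 1 h (S (S n)) x
      (even_mode (INR (S (S n)))) (even_mode' (INR (S (S n)))));
      auto using even_mode_jacobi, even_mode_parity.
    destruct (even_mode_steklov T (INR (S (S n))) HT Hlarge). nra.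
Qed.

Lemma odd_coef_zero (T delta : R) (h : bdry -> R) (n : nat) (x : R) :
  critical_height T -> eigenspace T delta h -> delta < 2 ->
  n <> 1%nat \/ delta <> 1 -> n <> 0%nat \/ delta <> 1 / sinh T ^ 2 ->
  cos_coef (parity_part (-1) h) n x = 0.
Proof.
  intros HT Hh Hd. pose proof (critical_height_gt_1 T HT) as HT1.
  destruct n as [|[|n]].
  - intros _ [H | H]; [easy |].
    apply (parity_coef_zero T delta (-1) h 0 x (odd_mode 0) (odd_mode' 0));
      auto using odd_mode_jacobi, odd_mode_parity.
    destruct (odd_mode_boundary T 0 HT) as [E ->]. rewrite E.
    rewrite !Rmult_0_l, cosh_0.
    rewrite inv_sinh_sqr in H by easy.
    intros Heq. apply H.
    apply (Rmult_eq_reg_r (/ T)); [| apply Rinv_neq_0_compat; lra].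
    replace ((T ^ 2 - 1) * / T) with (T - / T) by (field; lra). lra.
  - intros [H | H] _; [easy |].
    apply (parity_coef_zero T delta (-1) h 1 x odd_mode_1 odd_mode_1');
      auto using odd_mode_1_jacobi, odd_mode_1_parity.
    destruct (odd_mode_1_boundary T HT) as [Hpos ->]. intros Heq. apply H. nra.
  - intros _ _.
    assert (Hlarge : 2 <= INR (S (S n))) by (rewrite !S_INR; pose proof (pos_INR n); lra).
    apply (parity_coef_zero T delta (-1) h (S (S n)) x
      (odd_mode (INR (S (S n)))) (odd_mode' (INR (S (S n)))));
      auto using odd_mode_jacobi, odd_mode_parity.
    destruct (odd_mode_steklov T (INR (S (S n))) HT Hlarge). nra.
Qed.

Lemma parity_part_single_mode (sg : R) (h : bdry -> R) (m : nat) :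
  smooth_bdry_fun h ->
  (forall n x, n <> m -> cos_coef (parity_part sg h) n x = 0) ->
  exists a b, forall s, parity_part sg h s = a * cos (INR m * s) + b * sin (INR m * s).
Proof.
  intros Hh H0.
  destruct (cos_coef_period (parity_part sg h) m) as (a & b & Hab).
  - intros s. now apply parity_part_continuous.
  - intros s. now apply parity_part_period.
  - exists (a / cos_mass m), (b / cos_mass m). intros s.
    rewrite (single_cos_coef (parity_part sg h) m s), Hab.
    + pose proof (cos_mass_pos m). field. lra.
    + intros r. now apply parity_part_continuous.
    + auto.
Qed.

Lemma parity_part_zero (sg : R) (h : bdry -> R) (s : R) :
  smooth_bdry_fun h -> (forall n x, cos_coef (parity_part sg h) n x = 0) ->
  parity_part sg h s = 0.
Proof.
  intros Hh H0. apply cos_coef_zero; auto. intros r. now apply parity_part_continuous.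
Qed.

Lemma even_part_zero (T delta : R) (h : bdry -> R) (s : R) :
  critical_height T -> eigenspace T delta h -> delta < 2 -> delta <> - 1 ->
  parity_part 1 h s = 0.
Proof.
  intros HT Hh Hd Hne. apply parity_part_zero; [apply Hh |].
  intros n x. apply (even_coef_zero T delta); auto.
Qed.

Lemma odd_part_zero (T delta : R) (h : bdry -> R) (s : R) :
  critical_height T -> eigenspace T delta h -> delta < 2 ->
  delta <> 1 / sinh T ^ 2 -> delta <> 1 -> parity_part (-1) h s = 0.
Proof.
  intros HT Hh Hd Hne1 Hne2. apply parity_part_zero; [apply Hh |].
  intros n x. apply (odd_coef_zero T delta); auto.
Qed.

Lemma not_spectrum (T delta : R) :
  critical_height T -> delta < 2 -> delta <> - 1 -> delta <> 1 / sinh T ^ 2 -> delta <> 1 ->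
  ~ spectrum T delta.
Proof.
  intros HT Hd H1 H2 H3 (h & Hh & [b s] & Hne).
  pose proof (even_part_zero T delta h s HT Hh Hd H1) as He.
  pose proof (odd_part_zero T delta h s HT Hh Hd H2 H3) as Ho.
  unfold parity_part in *. apply Hne. destruct b; lra.
Qed.

(** * Eigenfunctions and multiplicities *)

Lemma harmonic_cos (k : R) : harmonic k (fun th => cos (k * th)) (fun th => - k * sin (k * th)).
Proof. split; derive_explicit. Qed.

Lemma harmonic_sin (k : R) : harmonic k (fun th => sin (k * th)) (fun th => k * cos (k * th)).
Proof. split; derive_explicit. Qed.

Lemma mode_eigenfunctions (T delta sg : R) (n : nat) (g g' : R -> R) :
  critical_height T -> jacobi_mode (INR n) g g' -> has_parity sg g g' ->
  T * g' T = delta * g T ->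
  eigenspace T delta (fun q => g (bdry_height T (fst q)) * cos (INR n * snd q)) /\
  eigenspace T delta (fun q => g (bdry_height T (fst q)) * sin (INR n * snd q)).
Proof.
  intros HT Hg Hsg Hd.
  assert (Hm : - T * g' (- T) = delta * g (- T)).
  { destruct (Hsg T) as [-> ->].
    transitivity (sg * (T * g' T)); [ring | rewrite Hd; ring]. }
  assert (Hper : forall th, INR n * (th + 2 * PI) = INR n * th + 2 * INR n * PI)
    by (intros; ring).
  split.
  - apply (separated_eigenfunction T delta (INR n) g g' (fun th => cos (INR n * th)) _ HT Hg
      (harmonic_cos (INR n))); auto.
    intros th. rewrite Hper. apply cos_period.
  - apply (separated_eigenfunction T delta (INR n) g g' (fun th => sin (INR n * th)) _ HT Hg
      (harmonic_sin (INR n))); auto.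
    intros th. rewrite Hper. apply sin_period.
Qed.

Lemma mode_spectrum (T delta sg : R) (n : nat) (g g' : R -> R) :
  critical_height T -> jacobi_mode (INR n) g g' -> has_parity sg g g' ->
  T * g' T = delta * g T -> g T <> 0 -> spectrum T delta.
Proof.
  intros HT Hg Hsg Hd Hne.
  destruct (mode_eigenfunctions T delta sg n g g' HT Hg Hsg Hd) as [Hc _].
  eexists. split; [exact Hc |]. exists (true, 0). simpl.
  now rewrite Rmult_0_r, cos_0, Rmult_1_r.
Qed.

Lemma lin_comb_1 {A : Type} (a : nat -> R) (e : nat -> A -> R) (x : A) :
  lin_comb 1 a e x = a 1%nat * e 1%nat x.
Proof. unfold lin_comb. now rewrite sum_n_n. Qed.

Lemma lin_comb_2 {A : Type} (a : nat -> R) (e : nat -> A -> R) (x : A) :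
  lin_comb 2 a e x = a 1%nat * e 1%nat x + a 2%nat * e 2%nat x.
Proof. unfold lin_comb. rewrite sum_n_Sm by lia. now rewrite sum_n_n. Qed.

Lemma multiplicity_mode_1 (T delta sg : R) (g g' : R -> R) :
  critical_height T -> jacobi_mode 1 g g' -> has_parity sg g g' ->
  T * g' T = delta * g T -> g T <> 0 ->
  (forall h, eigenspace T delta h -> exists a b, forall s,
     h (true, s) = a * cos s + b * sin s /\ h (false, s) = sg * h (true, s)) ->
  multiplicity T delta 2.
Proof.
  intros HT Hg Hsg Hd Hne Hspan.
  destruct (mode_eigenfunctions T delta sg 1 g g' HT Hg Hsg Hd) as [Hc Hs].
  set (ec := fun q : bdry => _) in Hc. set (es := fun q : bdry => _) in Hs.
  exists (fun i => if Nat.eqb i 1 then ec else es). split; [| split].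
  - intros i _. now destruct (Nat.eqb i 1).
  - intros a Ha i Hi.
    (* On the upper circle the angle 0 isolates the cosine and the angle [PI / 2] isolates the
       sine. *)
    pose proof (Ha (true, 0)) as H0. pose proof (Ha (true, PI / 2)) as H1.
    rewrite lin_comb_2 in H0, H1. unfold ec, es in H0, H1. simpl in H0, H1.
    rewrite Rmult_0_r, cos_0, sin_0 in H0. rewrite Rmult_1_l, cos_PI2, sin_PI2 in H1.
    assert (i = 1%nat \/ i = 2%nat) as [-> | ->] by lia;
      apply (Rmult_eq_reg_r (g T)); lra.
  - intros h Hh. destruct (Hspan h Hh) as (a & b & Hab).
    exists (fun i => if Nat.eqb i 1 then a / g T else b / g T).
    intros [bb s]. rewrite lin_comb_2. unfold ec, es. simpl. rewrite Rmult_1_l.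
    destruct (Hab s) as [E1 E2]. destruct bb; simpl.
    + rewrite E1. field. easy.
    + rewrite E2, E1, (proj1 (Hsg T)). field. easy.
Qed.

(** The profile is [1 / cosh], that of horizontal translations, with Robin quotient
    [- T tanh T = - 1]. *)
Lemma multiplicity_minus_1 (T : R) : critical_height T ->
  spectrum T (- 1) /\ multiplicity T (- 1) 2.
Proof.
  intros HT. pose proof (critical_height_gt_1 T HT).
  destruct (even_mode_boundary T 1 HT) as [E1 E2].
  assert (Hd : T * even_mode' 1 T = - 1 * even_mode 1 T) by (rewrite E1, E2; lra).
  assert (Hne : even_mode 1 T <> 0).
  { rewrite E1, !Rmult_1_l, (critical_cosh T HT).
    pose proof (critical_sinh_pos T HT).
    replace (T * sinh T - sinh T / T) with (sinh T * (T ^ 2 - 1) / T) by (field; lra).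
    apply Rgt_not_eq, Rdiv_lt_0_compat; [apply Rmult_lt_0_compat; nra | lra]. }
  pose proof (inv_sinh_sqr T HT) as Hi.
  split.
  - apply (mode_spectrum T (- 1) 1 1 (even_mode 1) (even_mode' 1));
      auto using even_mode_jacobi, even_mode_parity.
  - apply (multiplicity_mode_1 T (- 1) 1 (even_mode 1) (even_mode' 1));
      auto using even_mode_jacobi, even_mode_parity.
    intros h Hh.
    destruct (parity_part_single_mode 1 h 1) as (a & b & Hab); [apply Hh | |].
    { intros n x Hn. apply (even_coef_zero T (- 1)); auto; lra. }
    (* Since the odd part vanishes, [h] agrees on both circles and [parity_part 1 h] is twice it. *)
    exists (a / 2), (b / 2). intros s. specialize (Hab s).
    assert (Ho : parity_part (-1) h s = 0) by (apply (odd_part_zero T (- 1)); auto; nra).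
    simpl INR in Hab. rewrite Rmult_1_l in Hab. unfold parity_part in *. lra.
Qed.

Lemma multiplicity_1 (T : R) : critical_height T -> spectrum T 1 /\ multiplicity T 1 2.
Proof.
  intros HT. pose proof (critical_height_bounds T HT).
  destruct (odd_mode_1_boundary T HT) as [Hpos Hd].
  pose proof (inv_sinh_sqr T HT) as Hi.
  split.
  - apply (mode_spectrum T 1 (-1) 1 odd_mode_1 odd_mode_1');
      auto using odd_mode_1_jacobi, odd_mode_1_parity; lra.
  - apply (multiplicity_mode_1 T 1 (-1) odd_mode_1 odd_mode_1');
      auto using odd_mode_1_jacobi, odd_mode_1_parity; try lra.
    intros h Hh.
    destruct (parity_part_single_mode (-1) h 1) as (a & b & Hab); [apply Hh | |].
    { intros n x Hn. apply (odd_coef_zero T 1); auto; [lra | right; nra]. }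
    exists (a / 2), (b / 2). intros s. specialize (Hab s).
    assert (He : parity_part 1 h s = 0) by (apply (even_part_zero T 1); auto; lra).
    simpl INR in Hab. rewrite Rmult_1_l in Hab. unfold parity_part in *. lra.
Qed.

(** The profile is [- tanh], that of vertical translation. At frequency 0 the sine is zero, so only
    one eigenfunction remains. *)
Lemma multiplicity_inv_sinh_sqr (T : R) : critical_height T ->
  spectrum T (1 / sinh T ^ 2) /\ multiplicity T (1 / sinh T ^ 2) 1.
Proof.
  intros HT. pose proof (critical_height_bounds T HT).
  rewrite (inv_sinh_sqr T HT).
  destruct (odd_mode_boundary T 0 HT) as [E1 E2].
  rewrite !Rmult_0_l, cosh_0 in E1. rewrite !Rmult_0_l, cosh_0 in E2.
  assert (Hd : T * odd_mode' 0 T = (T ^ 2 - 1) * odd_mode 0 T)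
    by (rewrite E1, E2; field; lra).
  assert (Hne : odd_mode 0 T <> 0).
  { rewrite E1. pose proof (Rinv_0_lt_compat T). lra. }
  split.
  { apply (mode_spectrum T _ (-1) 0 (odd_mode 0) (odd_mode' 0));
      auto using odd_mode_jacobi, odd_mode_parity. }
  destruct (mode_eigenfunctions T _ (-1) 0 (odd_mode 0) (odd_mode' 0) HT
    (odd_mode_jacobi 0) (odd_mode_parity 0) Hd) as [Hc _].
  set (e := fun q : bdry => _) in Hc.
  exists (fun _ => e). split; [| split].
  - easy.
  - intros a Ha i Hi. pose proof (Ha (true, 0)) as H0. rewrite lin_comb_1 in H0.
    unfold e in H0. simpl in H0. rewrite Rmult_0_r, cos_0 in H0.
    replace i with 1%nat by lia. apply (Rmult_eq_reg_r (odd_mode 0 T)); lra.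
  - intros h Hh.
    destruct (parity_part_single_mode (-1) h 0) as (a & b & Hab); [apply Hh | |].
    { intros n x Hn. apply (odd_coef_zero T (T ^ 2 - 1)); auto; [nra | right; nra]. }
    exists (fun _ => a / 2 / odd_mode 0 T). intros [bb s]. rewrite lin_comb_1.
    specialize (Hab s). simpl INR in Hab. rewrite Rmult_0_l, cos_0, sin_0 in Hab.
    assert (He : parity_part 1 h s = 0) by (apply (even_part_zero T (T ^ 2 - 1)); auto; nra).
    unfold parity_part in *. unfold e. simpl. rewrite Rmult_0_l, cos_0.
    destruct bb; simpl.
    + transitivity (a / 2); [lra | field; easy].
    + rewrite (proj1 (odd_mode_parity 0 T)).
      transitivity (- (a / 2)); [lra | field; easy].
Qed.

Lemma spectrum_2 (T : R) : critical_height T -> spectrum T 2.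
Proof.
  intros HT. destruct (even_mode_steklov T 2 HT); [lra |].
  apply (mode_spectrum T 2 1 2 (even_mode 2) (even_mode' 2));
    auto using even_mode_jacobi, even_mode_parity, even_mode_2_boundary; lra.
Qed.

Theorem corollary4p1 :
  (exists! T : R, critical_height T) /\
  forall T : R, critical_height T ->
    eigenvalue_count_below T 1 3 /\
    (forall delta : R,
       spectrum T delta /\ delta < 1 <-> delta = 1 / sinh T ^ 2 \/ delta = - 1) /\
    rounds_to (1 / sinh T ^ 2) 4 0.4392 /\
    multiplicity T (1 / sinh T ^ 2) 1 /\
    multiplicity T (- 1) 2 /\
    (forall delta : R, 1 / sinh T ^ 2 < delta < 1 -> ~ spectrum T delta) /\
    next_eigenvalue T (1 / sinh T ^ 2) 1 /\
    multiplicity T 1 2 /\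
    exists delta : R, next_eigenvalue T 1 delta /\ rounds_to delta 5 2.
Proof.
  split; [exact critical_height_unique |].
  intros T HT. pose proof (critical_height_bounds T HT) as Hb.
  pose proof (inv_sinh_sqr T HT) as Hi.
  destruct (multiplicity_minus_1 T HT) as [Sm Mm].
  destruct (multiplicity_1 T HT) as [S1 M1].
  destruct (multiplicity_inv_sinh_sqr T HT) as [Si Mi].
  (* The rounding interval of 0.4392, shifted by 1; it also places [1 / sinh T ^ 2] strictly between
     -1 and 1. *)
  assert (Hr : 1 + 0.43915 < T ^ 2 < 1 + 0.43925) by nra.
  assert (Hlow : forall delta,
    spectrum T delta /\ delta < 1 <-> delta = 1 / sinh T ^ 2 \/ delta = - 1).
  { intros delta. split.
    - intros [Hs Hlt].
      destruct (Req_dec delta (1 / sinh T ^ 2)) as [| H1]; [now left |].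
      destruct (Req_dec delta (- 1)) as [| H2]; [now right |].
      exfalso. revert Hs. apply not_spectrum; auto; lra.
    - intros [-> | ->]; split; auto; lra. }
  assert (Hgap : forall delta, 1 / sinh T ^ 2 < delta < 1 -> ~ spectrum T delta).
  { intros delta Hd. apply not_spectrum; auto; lra. }
  set (d := 1 / sinh T ^ 2) in *.
  refine (conj _ (conj Hlow (conj _ (conj Mi (conj Mm (conj Hgap
    (conj (conj _ (conj S1 Hgap)) (conj M1 _)))))))).
  - exists ((d, 1%nat) :: (- 1, 2%nat) :: nil). split; [| split; [| split]].
    + simpl. constructor; [| constructor; [easy | constructor]].
      intros [H | []]. lra.
    + intros delta. rewrite Hlow. simpl. intuition.
    + intros delta m [H | [H | []]]; inversion H; now subst.
    + reflexivity.
  - rewrite Hi. apply Rabs_lt_between. simpl. lra.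
  - lra.
  - exists 2. split; [split; [lra | split; [now apply spectrum_2 |]] |].
    + intros delta Hd. apply not_spectrum; auto; fold d; lra.
    + unfold rounds_to. rewrite Rminus_diag, Rabs_R0. simpl. lra.
Qed.
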